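(* Suppose the potential $\xi^{(\epsilon)}$ satisfies conditions (1)–(3) listed in the context. Then for each integer $k\ge1$ there is $c>0$ such that for all $t>0$ and all $\epsilon\in(0,1)$ (with $|D_\epsilon|\ge k$, so that the $k$-th eigenvalue is defined), $$\mathbb{P}_\epsilon\Bigl(\bigl|\lambda^{(k)}_{D_\epsilon,\xi}-\mathbb{E}\lambda^{(k)}_{D_\epsilon,\xi}\bigr|>t\Bigr)\le 4\,e^{-c\,t^2\epsilon^{-d}}.$$
   Context: Let $D\subset\mathbb{R}^d$ be a (nonempty) bounded open set whose boundary is $C^{1,\alpha}$ for some $\alpha>0$. For $\epsilon>0$ set $D_\epsilon:=\{x\in\mathbb{Z}^d:\operatorname{dist}_\infty(x\epsilon,D^c)>\epsilon\}$, where $\operatorname{dist}_\infty$ is the $\ell^\infty$-distance in $\mathbb{R}^d$ and $D^c$ the complement of $D$. For real numbers $\xi^{(\epsilon)}(x)$, $x\in D_\epsilon$, let $H_{D_\epsilon,\xi}$ be the operator on functions $f:D_\epsilon\to\mathbb{R}$, extended by zero outside $D_\epsilon$ (Dirichlet condition), given for $x\in D_\epsilon$ by $$(H_{D_\epsilon,\xi}f)(x):=-\epsilon^{-2}(\Delta^{(d)}f)(x)+\xi^{(\epsilon)}(x)f(x),\qquad (\Delta^{(d)}f)(x):=\sum_{y\in\mathbb{Z}^d:\,|y-x|=1}[f(y)-f(x)],$$ with $|\cdot|$ the $\ell^1$-norm on $\mathbb{Z}^d$. Its eigenvalues, counted with multiplicity, are $\lambda^{(1)}_{D_\epsilon,\xi}\le\lambda^{(2)}_{D_\epsilon,\xi}\le\dots\le\lambda^{(|D_\epsilon|)}_{D_\epsilon,\xi}$.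 The superscript $(\epsilon)$ on $\xi$ is often omitted. Conditions on the random potential: there are reals $a<b$ and bounded continuous functions $U:D\to\mathbb{R}$, $V:D\to(0,\infty)$ such that for each $\epsilon>0$: (1) the random variables $\{\xi^{(\epsilon)}(x):x\in D_\epsilon\}$ are independent; (2) $a\le\xi^{(\epsilon)}(x)\le b$ for all $x\in D_\epsilon$; (3) $\mathbb{E}\,\xi^{(\epsilon)}(x)=U(x\epsilon)$ and $\operatorname{Var}(\xi^{(\epsilon)}(x))=V(x\epsilon)$ for all $x\in D_\epsilon$. $\mathbb{P}_\epsilon$ denotes the law of $\xi^{(\epsilon)}$ and $\mathbb{E}$ the corresponding expectation. *)

(* Defs.v *)
From HB Require Import structures.
From mathcomp Require Import all_boot all_order all_algebra finmap.
From mathcomp Require Import all_classical all_reals all_analysis.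
Import Order.TTheory GRing.Theory Num.Theory.
Import numFieldNormedType.Exports.

Set Implicit Arguments.
Unset Strict Implicit.
Unset Printing Implicit Defensive.

Local Open Scope classical_set_scope.
Local Open Scope ring_scope.

(* The norm, the balls and the topology of 'rV[R]_d are those of the
   sup norm; in particular [ball p r] below is an open cube. *)

Section Domain.
Context {R : realType} {d : nat}.
Implicit Types (D A : set 'rV[R]_d) (g : 'rV[R]_d -> R).

Definition C1_holder_on (alpha : R) A g : Prop :=
  (forall y, A y -> differentiable g y) /\
  exists C : R, forall (j : 'I_d) y z, A y -> A z ->
    `|'D_(delta_mx ord0 j) g y - 'D_(delta_mx ord0 j) g z|
      <= C * `|y - z| `^ alpha.

(* Near each of its boundary points, D is the set of points lying strictly on
   one side of the graph of a C^{1,alpha} function of d - 1 of the coordinates: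
   g is a function of the coordinates other than the i-th, and [flip] allows
   for D lying below the graph instead of above it. *)
Definition C1_holder_boundary (alpha : R) D : Prop :=
  forall p, (closure D `\` D°) p ->
    exists r : R, 0 < r /\
    exists (i : 'I_d) (flip : bool) (g : 'rV[R]_d -> R),
      [/\ forall y z : 'rV[R]_d, (forall j, j != i -> y ord0 j = z ord0 j) -> g y = g z,
          C1_holder_on alpha (ball p r) g
        & forall x, ball p r x -> (D x <-> g x < (-1) ^+ flip * x ord0 i)].

Definition dist_infty (x : 'rV[R]_d) A : \bar R :=
  ereal_inf [set `|x - z|%:E | z in A].

Definition scaled (e : R) (x : 'rV[int]_d) : 'rV[R]_d :=
  e *: map_mx intr x.

(* [fset_set] is the identity on finite sets, see [lattice_domainP]. *)
Definition lattice_domain D (e : R) : {fset 'rV[int]_d} :=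
  fset_set [set x | (e%:E < dist_infty (scaled e x) (~` D))%E].

End Domain.

Lemma finite_lattice_box (d M : nat) :
  finite_set [set x : 'rV[int]_d | forall i, `|x ord0 i| <= M%:Z].
Proof.
pose F (h : {ffun 'I_d -> 'I_(M + M).+1}) : 'rV[int]_d :=
  \row_i ((h i)%:Z - M%:Z).
apply: (@sub_finite_set _ _ (F @` setT)); last first.
  exact/finite_image/finite_finset.
move=> x /= xM; exists [ffun i => inord `|(x ord0 i + M%:Z)%R|%N] => //.
apply/rowP => i; rewrite !mxE ffunE ord1.
have /andP[h1 h2] : - M%:Z <= x ord0 i <= M%:Z by rewrite -ler_norml.
have h0 : 0 <= x ord0 i + M%:Z by rewrite -lerBlDr sub0r.
rewrite inordK; first by rewrite gez0_abs// addrK.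
by rewrite ltnS -lez_nat gez0_abs// PoszD lerD2r.
Qed.

Lemma lattice_domainP (R : realType) (d : nat) (D : set 'rV[R]_d) (e : R) :
  0 < e -> bounded_set D ->
  [set` lattice_domain D e] =
  [set x | (e%:E < dist_infty (scaled e x) (~` D))%E].
Proof.
move=> e0 [M0 [_ DM]]; rewrite fset_setK//.
have {}DM : forall x, D x -> `|x| <= `|M0| + 1.
  by apply: DM; rewrite (le_lt_trans (ler_norm _))// ltrDl.
pose N := (Num.truncn ((`|M0| + 1) / e)).+1.
apply: sub_finite_set (finite_lattice_box d N) => x /= xe i.
have Dx : D (scaled e x).
  apply: contrapT => nDx; move: xe; rewrite ltNge => /negP; apply.
  apply: (@le_trans _ _ `|scaled e x - scaled e x|%:E).
    by apply: ereal_inf_lbound; exists (scaled e x).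
  by rewrite subrr normr0 lee_fin ltW.
have := DM _ Dx => le1.
have : `|scaled e x ord0 i| <= `|M0| + 1.
  apply: le_trans le1; rewrite {2}/Num.norm/= mx_normrE.
  exact: (le_bigmax _ (fun ij => `|scaled e x ij.1 ij.2|) (ord0, i)).
rewrite /scaled !mxE normrM (gtr0_norm e0) -ler_pdivlMl// mulrC => h.
rewrite -(ler_int R) intr_norm; apply: (le_trans h).
rewrite /N ltW//; exact: truncnS_gt.
Qed.

Section Operator.
Context {R : realType} {d : nat}.

Definition l1norm (x : 'rV[int]_d) : int := \sum_i `|x ord0 i|.

Definition neighbors (x : 'rV[int]_d) : set 'rV[int]_d :=
  [set y | l1norm (y - x) = 1].

Definition lattice_laplacian (f : 'rV[int]_d -> R) (x : 'rV[int]_d) : R :=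
  \sum_(y \in neighbors x) (f y - f x).

Definition extend0 (S : {fset 'rV[int]_d}) (f : {ffun S -> R^o})
  (x : 'rV[int]_d) : R := oapp f 0 (insub x).

Definition anderson (e : R) (S : {fset 'rV[int]_d}) (xi : S -> R)
    (f : {ffun S -> R^o}) : {ffun S -> R^o} :=
  [ffun x : S => - (e ^- 2) * lattice_laplacian (extend0 f) (val x)
                 + xi x * f x].

Lemma finite_neighbors (x : 'rV[int]_d) : finite_set (neighbors x).
Proof.
pose N := (\sum_i `|x ord0 i|%N + 1)%N.
apply: sub_finite_set (finite_lattice_box d N) => y /= /[swap] i.
rewrite /neighbors/= /l1norm (bigD1 i)//= => h.
have h1 : `|(y - x) ord0 i| <= 1.
  by rewrite -h lerDl sumr_ge0.
rewrite -(subrK (x ord0 i) (y ord0 i)) (le_trans (ler_normD _ _))// addrC.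
rewrite /N PoszD lerD//; last by move: h1; rewrite !mxE.
by rewrite (bigD1 i)//= PoszD abszE lerDl.
Qed.

Lemma lattice_laplacian_linear a (f g : 'rV[int]_d -> R) x :
  lattice_laplacian (fun y => a * f y + g y) x =
  a * lattice_laplacian f x + lattice_laplacian g x.
Proof.
have fN := finite_neighbors x.
rewrite /lattice_laplacian !fsbig_finite//= mulr_sumr -big_split/=.
by apply: eq_bigr => y _; rewrite mulrBr opprD addrACA.
Qed.

Fact anderson_linear (e : R) (S : {fset 'rV[int]_d}) (xi : S -> R) :
  linear (anderson e xi).
Proof.
move=> a f g; apply/ffunP => x; rewrite !ffunE.
have -> : extend0 (a *: f + g) = (fun y => a * extend0 f y + extend0 g y).
  apply/funext => y; rewrite /extend0; case: insubP => [u _ _|_] /=.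
    by rewrite !ffunE.
  by rewrite mulr0 addr0.
rewrite lattice_laplacian_linear !mulrDr addrACA; congr (_ + _ ).
by rewrite scalerDr /GRing.scale/=; congr (_ + _); rewrite mulrCA.
Qed.
HB.instance Definition _ (e : R) (S : {fset 'rV[int]_d}) (xi : S -> R) :=
  GRing.isLinear.Build _ _ _ _ _ (anderson_linear e xi).

End Operator.

Section Spectrum.
Context {R : realType} {V : vectType R}.

Definition is_spectrum (T : 'End(V)) : set (seq R) :=
  [set s | sorted <=%R s /\
    forall a, count_mem a s = \dim (passmx.leigenspace T a)].

(* The nondecreasing list of the eigenvalues of T, each one repeated according
   to its multiplicity. *)
Definition spectrum (T : 'End(V)) : seq R := xget [::] (is_spectrum T).

(* k-th smallest eigenvalue, counting from k = 1. *)
Definition kth_eigenvalue (k : nat) (T : 'End(V)) : R :=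
  nth 0 (spectrum T) k.-1.

End Spectrum.

Section Probability.
Local Open Scope ereal_scope.

Definition mutually_independent (R : realType) (dO : measure_display)
    (Omega : measurableType dO) (P : probability Omega R)
    (I : finType) (X : I -> {RV P >-> R}) : Prop :=
  forall (J : {set I}) (B : I -> set R), (forall i, measurable (B i)) ->
    P (\bigcap_(i in [set` J]) (X i @^-1` B i)) =
    \prod_(i in J) P (X i @^-1` B i).

End Probability.

(* Main.v *)
Require Import Defs.
From HB Require Import structures.
From mathcomp Require Import all_boot all_order all_algebra finmap.
From mathcomp Require Import all_classical all_reals all_analysis.
From mathcomp Require complex.
From mathcomp Require Import measurable_realfun ring lra zify.
Import Order.TTheory GRing.Theory Num.Theory.
Import numFieldNormedType.Exports.

(** Resampling the potential at one site moves the [k]-th eigenvalue by at most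
    [O(e ^ d)], and there are [O(e ^- d)] sites, so the squares of these
    influences add up to [O(e ^ d)]; a bounded-differences (McDiarmid)
    inequality then gives a tail of order [exp (- c t ^ 2 e ^- d)].

    The influence of a site is controlled by delocalization of the low-lying
    eigenvectors.  By the min-max principle, a change of at most [b - a] of the
    potential at [x] moves the eigenvalue by at most [b - a] times the largest
    value of [f x ^ 2] among the unit vectors [f] spanned by the eigenvectors
    below it ([eigenvalue_perturbation]).  Such vectors live at energies bounded
    uniformly in [e], because [k] tent functions with disjoint supports of
    macroscopic size fit into [D] ([eigenvalue_uniform_bound]).  Bounded energy
    forces [f x ^ 2 <= C * e ^ d] ([delocalization]): with [H] the operator and
    [A = 1 - p e ^ 2 (H - a)], the eigenvalues of [A] on the span are
    [1 - O(e ^ 2)], so [f = A ^ n h] with [n] of order [e ^- 2] and [h] of norm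
    comparable to that of [f]; hence [f x] is the scalar product of [h] with
    [A ^ n] applied to the indicator of [x].  For small [p], [A] is a symmetric
    substochastic matrix, the transition matrix of a killed lazy random walk,
    and its [n]-step kernel has squared l2 norm [O(n ^ (- d / 2))].  This heat
    kernel bound comes from a Nash inequality on the lattice ([nash]), iterated
    over dyadic scales ([dyadic_decay]).

    On the probabilistic side the eigenvalue is 1-Lipschitz in the potential for
    the sup norm.  Hence it is a measurable function of the potential, and the
    potential may be rounded to a finite grid at the price of a small shift of
    [t].  By independence the rounded potential has a product law on a finite
    set, where McDiarmid's inequality is a statement about finite sums
    ([mcdiarmid]); [lipschitz_concentration] transfers it back. *)

Set Implicit Arguments.
Unset Strict Implicit.
Unset Printing Implicit Defensive.

Local Open Scope classical_set_scope.
Local Open Scope ring_scope.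

(** * Spectral theory of real symmetric operators *)

Section RealSymmetricMatrix.
Import complex.

(** Over the complex numbers the matrix is Hermitian, hence diagonalizable with
    real eigenvalues.  Its minimal polynomial is thus a product of distinct
    linear factors with real roots, and extending the field of scalars does not
    change minimal polynomials. *)
Lemma symmetric_diagonalizable (R : rcfType) n (A : 'M[R]_n) :
  A^T = A -> mxpoly.diagonalizable A.
Proof.
case: n A => [A _|n A symA].
  exists 1%:M; first exact: unitmx1.
  apply/mxpoly.diagonalizable_forPex; exists 0.
  by rewrite /mxpoly.simmx_to_for/= [X in X == _]flatmx0 [X in _ == X]flatmx0.
pose f := real_complex R; pose B := map_mx f A.
have rB : B \is a realmx.
  by apply/mxOverP => i j; rewrite mxE; apply/complex_realP; exists (A i j).
have hB : B \is hermsymmx.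
  apply: realsym_hermsym => //.
  by apply/is_hermitianmxP; rewrite expr0 scale1r map_mx_id// /B map_trmx symA.
have /hermitian_normalmx/orthomx_spectralP eB := hB.
have /mxOverP rD := hermitian_spectral_diag_real hB.
have uP := spectral_unit B.
set P := spectralmx B in eB uP.
have eP : mxpoly.conjmx P B = diag_mx (spectral_diag B).
  by rewrite mxpoly.conjumx// {1}eB mulmxA mulmxK// mulKVmx.
have dP : mxpoly.diagonalizable_for P B.
  by rewrite /mxpoly.simmx_to_for eP diag_mx_is_diag.
have := @mxpoly.diagonalizable_for_mxminpoly _ _ P B uP dP.
rewrite eP.
set rs := undup _ => mB.
have rsE r : r \in rs -> f (complex.Re r) = r.
  rewrite mem_undup => /mapP[i _ ->]; rewrite mxE eqxx mulr1n.
  by have /complex_realP[k ->] := rD ord0 i.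
pose ss := [seq complex.Re r | r <- rs].
have fss : map f ss = rs.
  by rewrite -map_comp -[RHS]map_id; apply/eq_in_map => r /rsE.
apply/mxpoly.diagonalizableP; exists ss.
  by rewrite -(map_inj_uniq (fmorph_inj f)) fss undup_uniq.
suff -> : mxminpoly A = \prod_(x <- ss) ('X - x%:P) by [].
apply: (map_poly_inj f); rewrite -mxminpoly_map -/B mB rmorph_prod -fss big_map.
by apply: eq_bigr => x _; rewrite rmorphB/= map_polyX map_polyC.
Qed.

End RealSymmetricMatrix.

Section SymmetricOperator.
Variables (R : realType) (I : finType).
Local Notation V := {ffun I -> R^o}.

Definition dot (f g : V) : R := \sum_x f x * g x.

Lemma dotC f g : dot f g = dot g f.
Proof. by apply: eq_bigr => x _; rewrite mulrC. Qed.

Lemma dotDl f g h : dot (f + g) h = dot f h + dot g h.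
Proof. by rewrite -big_split; apply: eq_bigr => x _; rewrite ffunE mulrDl. Qed.

Lemma dotZl a f h : dot (a *: f) h = a * dot f h.
Proof. by rewrite mulr_sumr; apply: eq_bigr => x _; rewrite ffunE -mulrA. Qed.

Lemma dot0l h : dot 0 h = 0.
Proof. by rewrite /dot big1// => x _; rewrite ffunE mul0r. Qed.

Lemma dotZr a f h : dot h (a *: f) = a * dot h f.
Proof. by rewrite dotC dotZl (dotC h). Qed.

Lemma dot0r h : dot h 0 = 0.
Proof. by rewrite dotC dot0l. Qed.

Lemma dotBl f g h : dot (f - g) h = dot f h - dot g h.
Proof. by rewrite -scaleN1r dotDl dotZl mulN1r. Qed.

Lemma dotBr f g h : dot h (f - g) = dot h f - dot h g.
Proof. by rewrite dotC dotBl !(dotC h). Qed.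

Lemma dot_suml (s : seq R) (F : R -> V) h :
  dot (\sum_(r <- s) F r) h = \sum_(r <- s) dot (F r) h.
Proof. by elim/big_ind2 : _ => [|? ? ? ? <- <-|]; rewrite ?dot0l ?dotDl. Qed.

Lemma dot_sumr (s : seq R) (F : R -> V) h :
  dot h (\sum_(r <- s) F r) = \sum_(r <- s) dot h (F r).
Proof. by rewrite dotC dot_suml; apply: eq_bigr => r _; rewrite dotC. Qed.

Lemma dot_ge0 f : 0 <= dot f f.
Proof. by apply: sumr_ge0 => x _; rewrite -expr2 sqr_ge0. Qed.

Lemma dot_eq0 f : (dot f f == 0) = (f == 0).
Proof.
apply/idP/eqP => [|->]; last by rewrite dot0l.
rewrite psumr_eq0 => [/allP f0|x _]; last by rewrite -expr2 sqr_ge0.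
apply/ffunP => x; rewrite ffunE; apply/eqP.
by have := f0 x (mem_index_enum x); rewrite /= mulf_eq0 orbb.
Qed.

Variable T : 'End(V).
Hypothesis symT : forall f g, dot (T f) g = dot f (T g).
Local Notation E := (passmx.leigenspace T).

Lemma mem_leigenspace r f : (f \in E r) = (T f == r *: f).
Proof.
by rewrite memv_ker add_lfunE opp_lfunE scale_lfunE id_lfunE subr_eq0.
Qed.

Definition site_indicator (x : I) : V := [ffun y => (y == x)%:R].

Lemma ffun_delta_sum (f : V) : f = \sum_x f x *: site_indicator x.
Proof.
apply/ffunP => y; rewrite sum_ffunE (bigD1 y)//= !ffunE eqxx big1.
  by rewrite addr0; exact/esym/mulr1.
by move=> x xy; rewrite !ffunE eq_sym (negPf xy); exact: mulr0.
Qed.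

Lemma dot_delta (f : V) x : dot f (site_indicator x) = f x.
Proof.
rewrite /dot (bigD1 x)//= ffunE eqxx mulr1 big1 ?addr0// => y yx.
by rewrite ffunE (negPf yx) mulr0.
Qed.

(** In the basis of the site indicators [T] has a symmetric matrix, and the
    eigenspaces of a diagonalizable matrix span the whole space. *)
Lemma eigen_decomposition : exists rs : seq R,
  uniq rs /\ (\sum_(r <- rs) E r)%VS = fullv.
Proof.
pose A : 'M[R]_#|I| := \matrix_(i, j) T (site_indicator (enum_val i)) (enum_val j).
have symA : A^T = A.
  by apply/matrixP => i j; rewrite !mxE -dot_delta symT dotC dot_delta.
have /mxpoly.diagonalizablePeigen[rs urs rsP] := symmetric_diagonalizable symA.
exists rs; split => //.
pose row (f : V) : 'rV[R]_#|I| := \row_i f (enum_val i).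
pose unrow (v : 'rV[R]_#|I|) : V := [ffun x => v ord0 (enum_rank x)].
have unrowK v : row (unrow v) = v.
  by apply/rowP => i; rewrite !mxE ffunE enum_valK.
have rowK f : unrow (row f) = f.
  by apply/ffunP => x; rewrite ffunE mxE enum_rankK.
have rowT f : row f *m A = row (T f).
  apply/rowP => j; rewrite !mxE [in RHS](ffun_delta_sum f) linear_sum sum_ffunE.
  rewrite (reindex (@enum_rank I))/=; last exact/onW_bij/enum_rank_bij.
  by apply: eq_bigr => i _; rewrite !mxE enum_rankK linearZ/= ffunE.
apply/vspaceP => f; rewrite memvf.
have : (row f <= \sum_(r <- rs) eigenspace A r)%MS by rewrite rsP submx1.
elim: rs f {urs rsP} => [|r rs IH] f.
  rewrite !big_nil submx0 => /eqP f0.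
  rewrite (_ : f = 0) ?mem0v// -(rowK f) f0.
  by apply/ffunP => x; rewrite !ffunE mxE.
rewrite !big_cons => /sub_addsmxP[[u v] /= fuv].
have -> : f = unrow (u *m eigenspace A r) +
    unrow (v *m (\sum_(r <- rs) eigenspace A r)%MS).
  by rewrite -[LHS]rowK fuv; apply/ffunP => x; rewrite !ffunE !mxE.
apply: memv_add; last by apply: IH; rewrite unrowK submxMl.
rewrite mem_leigenspace; apply/eqP; rewrite -[LHS]rowK -rowT unrowK.
have /eigenspaceP -> := submxMl u (eigenspace A r).
by apply/ffunP => x; rewrite !ffunE !mxE.
Qed.

Lemma leigenspace_orthogonal r r' f g :
  r != r' -> f \in E r -> g \in E r' -> dot f g = 0.
Proof.
rewrite !mem_leigenspace => rr' /eqP Tf /eqP Tg.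
have := symT f g; rewrite Tf Tg dotZl dotZr => /eqP.
by rewrite -subr_eq0 -mulrBl mulf_eq0 subr_eq0 (negPf rr')/= => /eqP.
Qed.

Lemma eigen_sumP s f : uniq s -> f \in (\sum_(r <- s) E r)%VS ->
  exists F : R -> V, (forall r, F r \in E r) /\ f = \sum_(r <- s) F r.
Proof.
elim: s f => [|r s IH] f /=.
  rewrite !big_nil memv0 => _ /eqP ->; exists (fun=> 0); rewrite big_nil.
  by split=> // r; rewrite mem0v.
rewrite big_cons => /andP[rs us] /memv_addP[u uE [v /(IH _ us)[F [FE ->]] ->]].
exists (fun x => if x == r then u else F x); split.
  by move=> x; case: eqP => [->|_]; [exact: uE|exact: FE].
rewrite big_cons eqxx; congr (_ + _); apply: eq_big_seq => x xs.
by case: eqP => // xr; rewrite xr (negPf rs) in xs *.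
Qed.

Lemma dot_eigen_sum s (F : R -> V) (a b : R -> R) : uniq s ->
    (forall r, F r \in E r) ->
  dot (\sum_(r <- s) a r *: F r) (\sum_(r <- s) b r *: F r) =
  \sum_(r <- s) a r * b r * dot (F r) (F r).
Proof.
move=> us FE; rewrite dot_suml; apply: eq_big_seq => r rs.
rewrite dotZl dot_sumr (bigD1_seq r)//= big1 ?addr0 ?dotZr ?mulrA//.
by move=> r' r'r; rewrite dotZr (leigenspace_orthogonal _ (FE r) (FE r')) ?mulr0// eq_sym.
Qed.

Lemma eigen_sum_op s (F : R -> V) (a : R -> R) :
    (forall r, F r \in E r) ->
  T (\sum_(r <- s) a r *: F r) = \sum_(r <- s) (a r * r) *: F r.
Proof.
move=> FE; rewrite linear_sum; apply: eq_bigr => r _.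
by have := FE r; rewrite mem_leigenspace linearZ/= => /eqP ->; rewrite scalerA.
Qed.

Lemma dim_eigen_sum s : uniq s ->
  \dim (\sum_(r <- s) E r)%VS = (\sum_(r <- s) \dim (E r))%N.
Proof.
elim: s => [|r s IH]; first by rewrite !big_nil dimv0.
move=> /= /andP[rs us]; rewrite !big_cons -IH// dimv_disjoint_sum//.
apply/eqP; rewrite -subv0; apply/subvP => v; rewrite memv_cap memv0 -dot_eq0.
move=> /andP[vr /(eigen_sumP us)[F [FE vF]]].
rewrite {2}vF dot_sumr big_seq big1// => x xs.
apply: (leigenspace_orthogonal _ vr (FE x)).
by apply: contraNneq rs => ->.
Qed.

Lemma leigenspace_eq0 rs a : uniq rs -> (\sum_(r <- rs) E r)%VS = fullv ->
  a \notin rs -> E a = 0%VS.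
Proof.
move=> urs rsE ars; apply/eqP; rewrite -subv0; apply/subvP => v vE.
rewrite memv0 -dot_eq0.
have : v \in (\sum_(r <- rs) E r)%VS by rewrite rsE memvf.
move=> /(eigen_sumP urs)[F [FE vF]].
rewrite {2}vF dot_sumr big_seq big1// => x xs.
apply: (leigenspace_orthogonal _ vE (FE x)).
by apply: contraNneq ars => ->.
Qed.

Lemma spectrumP : is_spectrum T (spectrum T).
Proof.
have [rs [urs rsE]] := eigen_decomposition.
apply: xgetPex => /=.
exists (sort <=%R (flatten [seq nseq (\dim (E r)) r | r <- rs])); split.
  exact/sort_sorted/le_total.
move=> a; rewrite (seq.permP (permEl (perm_sort _ _))) count_flatten -map_comp.
rewrite sumnE big_map /=.
have [ars|ars] := boolP (a \in rs).
  rewrite (bigD1_seq a)//= count_nseq /= eqxx mul1n big1 ?addn0// => r ra.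
  by rewrite count_nseq /= (negPf ra).
rewrite big_seq big1 => [|r rrs].
  by rewrite (leigenspace_eq0 urs rsE ars) dimv0.
by rewrite count_nseq/=; case: eqP => // ra; rewrite -ra rrs in ars.
Qed.

(** Translates positions in the sorted list [spectrum T] into dimensions of
    spans of eigenspaces, the form in which the min-max principle is used. *)
Lemma dim_eigen_sum_pred (rs : seq R) (p : pred R) :
    uniq rs -> (\sum_(r <- rs) E r)%VS = fullv ->
  \dim (\sum_(r <- [seq r <- rs | p r]) E r)%VS = count p (spectrum T).
Proof.
move=> urs rsE; have [_ cs] := spectrumP.
have srs x : x \in spectrum T -> x \in rs.
  rewrite -has_pred1 has_count cs lt0n dimv_eq0; apply: contraNT => xrs.
  by rewrite (leigenspace_eq0 urs rsE xrs).
rewrite dim_eigen_sum ?filter_uniq// big_filter.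
under eq_bigr do rewrite -cs -sum1_count big_mkcond/=.
rewrite exchange_big/= -sum1_count [RHS]big_mkcond/=.
apply: eq_big_seq => x /srs xrs.
rewrite -big_mkcondr/= (eq_bigl (fun i => (i == x) && p x)); last first.
  by move=> i; rewrite eq_sym andbC; case: eqP => // ->.
case: (p x); last by rewrite big_pred0// => i; rewrite andbF.
under eq_bigl do rewrite andbT.
by rewrite -big_filter filter_pred1_uniq// big_seq1.
Qed.

Lemma size_spectrum : size (spectrum T) = #|I|.
Proof.
have [rs [urs rsE]] := eigen_decomposition.
rewrite -count_predT -(dim_eigen_sum_pred _ urs rsE).
by rewrite (eq_filter (a2 := predT))// filter_predT rsE dimvf /dim/= muln1.
Qed.

(** The subspace that realizes the minimum in the min-max formula. *)
Lemma low_eigenspaces k : (0 < k <= #|I|)%N ->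
  exists s : seq R, [/\ uniq s, {in s, forall r, r <= kth_eigenvalue k T}
    & (k <= \dim (\sum_(r <- s) E r)%VS)%N].
Proof.
move=> /andP[k0 kI]; have [rs [urs rsE]] := eigen_decomposition.
set la := kth_eigenvalue k T.
exists [seq r <- rs | r <= la]; split; first exact: filter_uniq.
  by move=> r; rewrite mem_filter => /andP[].
rewrite dim_eigen_sum_pred//.
have [ss _] := spectrumP; set s := spectrum T in ss *.
have sz : (k <= size s)%N by rewrite size_spectrum.
rewrite -[s](cat_take_drop k) count_cat.
rewrite (_ : count _ (take k s) = k) ?leq_addr//.
have szk : size (take k s) = k by rewrite size_takel.
rewrite -[RHS]szk; apply/eqP; rewrite -all_count; apply/(all_nthP 0) => i.
rewrite szk => ik; rewrite nth_take//.
apply: (sorted_leq_nth le_trans le_refl 0 ss); rewrite ?inE/=; last 1 first.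
- by rewrite -ltnS prednK.
- exact: leq_trans ik sz.
- by rewrite prednK.
Qed.

Lemma dot_eigen_sum_op_le s mu f : uniq s -> {in s, forall r, r <= mu} ->
  f \in (\sum_(r <- s) E r)%VS -> dot f (T f) <= mu * dot f f.
Proof.
move=> us smu /(eigen_sumP us)[F [FE fF]].
have {}fF : f = \sum_(r <- s) 1 *: F r.
  by rewrite fF; apply: eq_bigr => r _; rewrite scale1r.
rewrite {2}fF eigen_sum_op// {1}fF dot_eigen_sum// {1 2}fF dot_eigen_sum//.
rewrite mulr_sumr big_seq [leRHS]big_seq; apply: ler_sum => r rs.
by rewrite !mul1r ler_wpM2r ?dot_ge0// smu.
Qed.

Lemma dot_eigen_sum_op_ge s mu f : uniq s -> {in s, forall r, mu <= r} ->
  f \in (\sum_(r <- s) E r)%VS -> mu * dot f f <= dot f (T f).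
Proof.
move=> us smu /(eigen_sumP us)[F [FE fF]].
have {}fF : f = \sum_(r <- s) 1 *: F r.
  by rewrite fF; apply: eq_bigr => r _; rewrite scale1r.
rewrite {4}fF eigen_sum_op// {3}fF dot_eigen_sum// {1 2}fF dot_eigen_sum//.
rewrite mulr_sumr big_seq [leRHS]big_seq; apply: ler_sum => r rs.
by rewrite !mul1r ler_wpM2r ?dot_ge0// smu.
Qed.

(** The min-max principle: the span of the eigenspaces at or above the [k]-th
    eigenvalue has codimension less than [k], so it meets [W] in a nonzero
    vector, on which both bounds on the quadratic form hold. *)
Lemma kth_eigenvalue_le k (W : {vspace V}) mu : (0 < k <= #|I|)%N ->
  (k <= \dim W)%N -> (forall f, f \in W -> dot f (T f) <= mu * dot f f) ->
  kth_eigenvalue k T <= mu.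
Proof.
move=> /andP[k0 kI] kW Wmu; have [rs [urs rsE]] := eigen_decomposition.
set la := kth_eigenvalue k T.
pose W' := (\sum_(r <- [seq r <- rs | (la <= r)%R]) E r)%VS.
have [ss _] := spectrumP.
have sz := size_spectrum.
have dW' : (#|I| - k.-1 <= \dim W')%N.
  rewrite /W' dim_eigen_sum_pred// -[X in count _ X](cat_take_drop k.-1) count_cat.
  apply: leq_trans (leq_addl _ _); rewrite -sz -size_drop.
  rewrite leq_eqVlt eq_sym -all_count; apply/orP; left.
  apply/(all_nthP 0) => i; rewrite size_drop nth_drop => ik.
  apply: (sorted_leq_nth le_trans le_refl 0 ss); rewrite ?inE/=.
  - by rewrite sz prednK.
  - by rewrite -ltn_subRL.
  - exact: leq_addr.
have : (W :&: W' != 0)%VS.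
  rewrite -dimv_eq0 -lt0n -(ltn_add2l (\dim (W + W'))) addn0 dimv_sum_cap.
  apply: (@leq_ltn_trans #|I|).
    by apply: leq_trans (dimvS (subvf _)) _; rewrite dimvf /dim/= muln1.
  apply: leq_trans (leq_add kW dW'); rewrite -{1}(prednK k0) addSn ltnS.
  by rewrite subnKC// (leq_trans (leq_pred k)).
rewrite -vpick0.
have := memv_pick (W :&: W')%VS; set f := vpick _.
rewrite memv_cap => /andP[fW fW'] f0.
have f_gt0 : 0 < dot f f by rewrite lt_def dot_ge0 dot_eq0 f0.
rewrite -(ler_pM2r f_gt0); apply: le_trans (Wmu _ fW).
apply: (dot_eigen_sum_op_ge _ _ fW'); first exact: filter_uniq.
by move=> r; rewrite mem_filter => /andP[].
Qed.

(** On eigenspaces below [mu] the operator [1 - dl (T - a)] has eigenvalues at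
    least [1 - dl (mu - a) > 0], so [n] of its iterates can be undone there with
    control on the norm. *)
Lemma inverse_iterate s mu (a dl : R) n f : uniq s ->
    {in s, forall r, r <= mu} -> 0 <= dl -> 0 < 1 - dl * (mu - a) ->
    f \in (\sum_(r <- s) E r)%VS ->
  exists h, iter n (fun u => u - dl *: (T u - a *: u)) h = f /\
    (1 - dl * (mu - a)) ^+ (2 * n) * dot h h <= dot f f.
Proof.
move=> us smu dl0 th0 /(eigen_sumP us)[F [FE fF]].
pose al r := 1 - dl * (r - a); pose th := 1 - dl * (mu - a).
have al_ge r : r \in s -> th <= al r.
  by move=> rs; rewrite lerD2l lerN2 ler_wpM2l// lerD2r smu.
have al_gt r : r \in s -> 0 < al r by move=> /al_ge; exact: lt_le_trans.
have step c : \sum_(r <- s) c r *: F r -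
    dl *: (T (\sum_(r <- s) c r *: F r) - a *: (\sum_(r <- s) c r *: F r)) =
    \sum_(r <- s) (c r * al r) *: F r.
  rewrite eigen_sum_op// scaler_sumr -sumrB scaler_sumr -sumrB.
  apply: eq_bigr => r _; rewrite scalerA -scalerBl scalerA -scalerBl.
  by congr (_ *: _); rewrite /al; ring.
(* powers of the operator act diagonally on eigencomponents *)
have iterE c m : iter m (fun u => u - dl *: (T u - a *: u))
    (\sum_(r <- s) c r *: F r) = \sum_(r <- s) (c r * al r ^+ m) *: F r.
  elim: m => [|m IH]; first by apply: eq_bigr => r _; rewrite expr0 mulr1.
  by rewrite iterS IH step; apply: eq_bigr => r _; rewrite -mulrA -exprSr.
(* rescaling each eigencomponent of [f] inverts the [n] iterations *)
exists (\sum_(r <- s) (al r ^- n) *: F r); split.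
  rewrite iterE fF; apply: eq_big_seq => r rs.
  by rewrite mulVf ?scale1r// expf_neq0// gt_eqF// al_gt.
have -> : f = \sum_(r <- s) 1 *: F r.
  by rewrite fF; apply: eq_bigr => r _; rewrite scale1r.
rewrite !dot_eigen_sum// mulr_sumr big_seq [leRHS]big_seq; apply: ler_sum => r rs.
rewrite mulr1 mulrA ler_wpM2r ?dot_ge0// -invfM -exprD addnn -mul2n.
rewrite ler_pdivrMr ?exprn_gt0 ?al_gt// mul1r lerXn2r ?nnegrE ?al_ge//.
- exact: ltW.
- by rewrite ltW// al_gt.
Qed.

End SymmetricOperator.

(** * Sums over the lattice and a Nash inequality *)

Section LatticeSum.
Variables (R : realType) (Z : zmodType).
Implicit Types (f g : Z -> R).

(** Summing over the whole group makes the sums invariant under translation.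
    The value is 0 by convention when [f] has infinite support, whence the
    [fin_supp] side conditions below. *)
Definition zsum f : R := \sum_(x \in [set: Z]) f x.

Definition fin_supp f : Prop :=
  exists B : {fset Z}, forall x, x \notin B -> f x = 0.

Lemma zsumE f (B : {fset Z}) : (forall x, x \notin B -> f x = 0) ->
  zsum f = \sum_(x <- B) f x.
Proof. exact: fsbigTE. Qed.

Lemma fin_supp_sub f g : fin_supp f -> (forall x, f x = 0 -> g x = 0) -> fin_supp g.
Proof. by move=> [B fB] fg; exists B => x /fB/fg. Qed.

Lemma fin_supp_add f g : fin_supp f -> fin_supp g -> fin_supp (fun x => f x + g x).
Proof.
move=> [B fB] [C gC]; exists (B `|` C)%fset => x.
by rewrite inE negb_or => /andP[/fB -> /gC ->]; rewrite addr0.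
Qed.

Lemma fin_supp_opp f : fin_supp f -> fin_supp (fun x => - f x).
Proof. by move=> /fin_supp_sub; apply=> x ->; rewrite oppr0. Qed.

Lemma fin_supp_sum (I : Type) (s : seq I) (F : I -> Z -> R) :
  (forall i, fin_supp (F i)) -> fin_supp (fun x => \sum_(i <- s) F i x).
Proof.
move=> Fs; elim: s => [|i s IH].
  by exists fset0 => x _; rewrite big_nil.
by apply: fin_supp_sub (fin_supp_add (Fs i) IH) _ => x; rewrite big_cons.
Qed.

Lemma fin_supp_mull f g : fin_supp f -> fin_supp (fun x => f x * g x).
Proof. by move=> /fin_supp_sub; apply=> x ->; rewrite mul0r. Qed.

Lemma fin_supp_mulr f g : fin_supp g -> fin_supp (fun x => f x * g x).
Proof. by move=> /fin_supp_sub; apply=> x ->; rewrite mulr0. Qed.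

Lemma fin_supp_sqr f : fin_supp f -> fin_supp (fun x => f x ^+ 2).
Proof. by move=> /fin_supp_sub; apply=> x ->; rewrite expr0n. Qed.

Lemma fin_supp_norm f : fin_supp f -> fin_supp (fun x => `|f x|).
Proof. by move=> /fin_supp_sub; apply=> x ->; rewrite normr0. Qed.

Lemma fin_supp_shift f h : fin_supp f -> fin_supp (fun x => f (x + h)).
Proof.
move=> [B fB]; exists [fset x - h | x in B]%fset => x xB; apply: fB.
by apply: contra xB => xB; apply/imfsetP; exists (x + h) => //; rewrite addrK.
Qed.

Lemma zsumD f g : fin_supp f -> fin_supp g ->
  zsum (fun x => f x + g x) = zsum f + zsum g.
Proof.
move=> [B fB] [C gC].
have fBC x : x \notin (B `|` C)%fset -> f x = 0.
  by rewrite inE negb_or => /andP[/fB].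
have gBC x : x \notin (B `|` C)%fset -> g x = 0.
  by rewrite inE negb_or => /andP[_ /gC].
rewrite (zsumE fBC) (zsumE gBC) -big_split; apply: zsumE => x xBC.
by rewrite fBC// gBC// addr0.
Qed.

Lemma zsumZ a f : zsum (fun x => a * f x) = a * zsum f.
Proof. by rewrite /zsum mulr_fsumr. Qed.

Lemma zsumN f : zsum (fun x => - f x) = - zsum f.
Proof. by rewrite -mulN1r -zsumZ; congr zsum; apply/funext => x; rewrite mulN1r. Qed.

Lemma zsumB f g : fin_supp f -> fin_supp g ->
  zsum (fun x => f x - g x) = zsum f - zsum g.
Proof. by move=> ff fg; rewrite zsumD ?zsumN//; exact: fin_supp_opp. Qed.

Lemma zsum_shift f h : zsum (fun x => f (x + h)) = zsum f.
Proof.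
rewrite /zsum [RHS](reindex_fsbigT (fun x => x + h))//.
by exists (fun x => x - h) => x; rewrite ?addrK ?subrK.
Qed.

Lemma zsum_ge0 f : (forall x, 0 <= f x) -> 0 <= zsum f.
Proof. by move=> f0; apply: fsumr_ge0. Qed.

Lemma ler_zsum f g : fin_supp f -> fin_supp g -> (forall x, f x <= g x) ->
  zsum f <= zsum g.
Proof.
move=> ff fg fleg; rewrite -subr_ge0 -zsumB//; apply: zsum_ge0 => x.
by rewrite subr_ge0.
Qed.

Lemma zsum_sum (I : Type) (s : seq I) (F : I -> Z -> R) :
  (forall i, fin_supp (F i)) ->
  zsum (fun x => \sum_(i <- s) F i x) = \sum_(i <- s) zsum (F i).
Proof.
move=> Fs; elim: s => [|i s IH].
  by rewrite big_nil /zsum fsbig1// => x _; rewrite big_nil.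
rewrite big_cons -IH -zsumD//; last exact: fin_supp_sum.
by congr zsum; apply/funext => x; rewrite big_cons.
Qed.

Lemma sum_inj_le_zsum (I : finType) (h : I -> Z) f : injective h ->
  fin_supp f -> (forall x, 0 <= f x) -> \sum_i f (h i) <= zsum f.
Proof.
move=> hI [B fB] f0.
pose C := (B `|` [fset h i | i in I])%fset.
have fC x : x \notin C -> f x = 0 by rewrite inE negb_or => /andP[/fB].
rewrite (zsumE fC) -(big_map h xpredT f) [leRHS](bigID (mem (codom h)))/=.
rewrite -[X in _ <= X + _]big_filter -[leLHS]addr0 lerD//; last by rewrite sumr_ge0.
rewrite le_eqVlt; apply/orP; left; apply/eqP.
apply: perm_big; apply: uniq_perm.
- by rewrite map_inj_uniq ?index_enum_uniq.
- by rewrite filter_uniq ?fset_uniq.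
move=> x; rewrite mem_filter; apply/idP/andP.
  move=> /mapP[i _ ->]; split; first exact: codom_f.
  by rewrite /C !inE; apply/orP; right; apply/imfsetP; exists i.
by move=> [/codomP[i ->] _]; apply/map_f/mem_index_enum.
Qed.

End LatticeSum.

Section Nash.
Variables (R : realType) (d : nat).
Local Notation Z := 'rV[int]_d.
Implicit Types (f g : Z -> R) (h : Z).

Definition unit_vec (i : 'I_d) : Z := delta_mx ord0 i.

Definition sqnorm f : R := zsum (fun x => f x ^+ 2).

Definition shift_sqdist f h : R := zsum (fun x => (f (x + h) - f x) ^+ 2).

Definition energy f : R := \sum_i shift_sqdist f (unit_vec i).

Lemma fin_supp_shiftB f h : fin_supp f -> fin_supp (fun x => f (x + h) - f x).
Proof.
by move=> fs; apply: fin_supp_add; [exact: fin_supp_shift|exact: fin_supp_opp].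
Qed.

Lemma shift_sqdist_ge0 f h : 0 <= shift_sqdist f h.
Proof. by apply: zsum_ge0 => x; exact: sqr_ge0. Qed.

Lemma energy_ge0 f : 0 <= energy f.
Proof. by apply: sumr_ge0 => i _; exact: shift_sqdist_ge0. Qed.

(** Telescoping along a path of [n] unit steps: by the triangle inequality the
    l2 distance from [f] to its translate grows at most linearly in [n]. *)
Lemma shift_sqdist_path f (s : seq 'I_d) : fin_supp f ->
  shift_sqdist f (\sum_(i <- s) unit_vec i) <= (size s)%:R ^+ 2 * energy f.
Proof.
move=> fs; elim: s => [|i s IH].
  rewrite big_nil /shift_sqdist /zsum fsbig1 ?expr0n ?mul0r// => x _.
  by rewrite addr0 subrr expr0n.
have Di : shift_sqdist f (unit_vec i) <= energy f.
  by rewrite /energy (bigD1 i)//= lerDl sumr_ge0// => j _; exact: shift_sqdist_ge0.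
rewrite big_cons; case: s IH => [_|j s IH].
  by rewrite big_nil addr0 expr1n mul1r.
set h := \sum_(i <- _) _ in IH *; set n : R := (size (j :: s))%:R in IH *.
have n0 : 0 < n by rewrite ltr0n.
have -> : (size (i :: j :: s))%:R = n + 1 :> R by rewrite /n /= -natr1.
rewrite -(ler_pM2l n0).
(* [(u + v) ^ 2 <= (1 + n) u ^ 2 + (1 + n^-1) v ^ 2], multiplied by [n] *)
have H : n * shift_sqdist f (unit_vec i + h) <=
    n * (n + 1) * shift_sqdist f (unit_vec i) + (n + 1) * shift_sqdist f h.
  rewrite /shift_sqdist -[X in _ * _ * X](zsum_shift _ h) -!zsumZ -zsumD.
  - apply: ler_zsum.
    + exact/fin_supp_mulr/fin_supp_sqr/fin_supp_shiftB.
    + apply: fin_supp_add; apply/fin_supp_mulr.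
        exact: (fin_supp_shift h (fin_supp_sqr (fin_supp_shiftB (unit_vec i) fs))).
      exact/fin_supp_sqr/fin_supp_shiftB.
    + move=> x; rewrite (addrC (unit_vec i)) addrA.
      move: (f (x + h + unit_vec i)) (f (x + h)) (f x) => u v w.
      rewrite -subr_ge0.
      suff -> : n * (n + 1) * (u - v) ^+ 2 + (n + 1) * (v - w) ^+ 2 -
        n * (u - w) ^+ 2 = (n * (u - v) - (v - w)) ^+ 2 by exact: sqr_ge0.
      by ring.
  - apply/fin_supp_mulr.
    exact: (fin_supp_shift h (fin_supp_sqr (fin_supp_shiftB (unit_vec i) fs))).
  - exact/fin_supp_mulr/fin_supp_sqr/fin_supp_shiftB.
apply: (le_trans H).
have -> : n * ((n + 1) ^+ 2 * energy f) =
  n * (n + 1) * energy f + (n + 1) * (n ^+ 2 * energy f) by ring.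
by rewrite lerD// ler_wpM2l// ?mulr_ge0 ?addr_ge0// ltW.
Qed.

Lemma sqnorm_shift f h : fin_supp f ->
  sqnorm f = shift_sqdist f h / 2 + zsum (fun x => f x * f (x + h)).
Proof.
move=> fs; have fs2 := fin_supp_sqr fs.
have -> : shift_sqdist f h =
    zsum (fun x => f (x + h) ^+ 2) + zsum (fun x => f x ^+ 2) -
    2 * zsum (fun x => f x * f (x + h)).
  rewrite -zsumD//; last exact: (fin_supp_shift h fs2).
  rewrite -zsumZ -zsumB.
  - by congr zsum; apply/funext => x; ring.
  - by apply: fin_supp_add => //; exact: (fin_supp_shift h fs2).
  - exact/fin_supp_mulr/fin_supp_mull.
by rewrite (zsum_shift (fun x => f x ^+ 2)) /sqnorm; field.
Qed.

Lemma row_path (w : 'I_d -> nat) : exists s : seq 'I_d,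
  size s = (\sum_i w i)%N /\ \row_i (w i)%:Z = \sum_(i <- s) unit_vec i.
Proof.
suff [s [szs sE]] : exists s : seq 'I_d, size s = (\sum_i w i)%N /\
    \sum_(i <- s) unit_vec i = \sum_i unit_vec i *+ w i.
  exists s; split=> //; rewrite sE; apply/rowP => j; rewrite mxE summxE.
  rewrite (bigD1 j)//= big1 => [|i ij]; rewrite mulmxnE mxE eqxx/= ?eqxx.
    by rewrite addr0 -[LHS]natz.
  by rewrite eq_sym (negPf ij) mul0rn.
elim: (index_enum _) => [|i r [s [szs sE]]].
  by exists [::]; rewrite !big_nil.
exists (nseq (w i) i ++ s); rewrite !big_cons size_cat size_nseq szs; split => //.
rewrite big_cat/= sE; congr (_ + _).
elim: (w i) => [|n IH]; first by rewrite big_nil mulr0n.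
by rewrite big_cons IH mulrS.
Qed.

(** An additive Nash inequality with a free length scale [m].  For each
    translation [h] the squared norm of [f] is half the squared distance from
    [f] to its translate plus their correlation.  Averaging over the [m ^ d]
    vectors [h] of a cube, the first term is bounded through paths of at most
    [d * m] steps, and the correlations add up to at most the squared l1 norm,
    since for fixed [x] the points [x + h] are distinct. *)
Lemma nash f m : fin_supp f -> (0 < m)%N ->
  sqnorm f <= (d * m)%:R ^+ 2 / 2 * energy f +
              m%:R ^- d * zsum (fun x => `|f x|) ^+ 2.
Proof.
move=> fs m0; pose pt (w : {ffun 'I_d -> 'I_m}) : Z := \row_i (w i)%:Z.
have ptI : injective pt.
  move=> v w /rowP vw; apply/ffunP => i; apply/val_inj => /=.
  by have := vw i; rewrite !mxE => -[].
have each w : sqnorm f <= (d * m)%:R ^+ 2 / 2 * energy f +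
    zsum (fun x => `|f x| * `|f (x + pt w)|).
  rewrite (sqnorm_shift (pt w) fs) lerD//; last first.
    apply: ler_zsum; [exact: fin_supp_mull| |].
      exact/fin_supp_mull/fin_supp_norm.
    by move=> x; rewrite -normrM ler_norm.
  rewrite mulrAC ler_pM2r ?invr_gt0//.
  have [s [szs sE]] := row_path (fun i => w i); rewrite /pt sE.
  apply: le_trans (shift_sqdist_path _ fs) _.
  rewrite ler_wpM2r ?energy_ge0// lerXn2r ?nnegrE// ler_nat szs.
  rewrite -[X in (_ <= X * _)%N](card_ord d) -sum_nat_const.
  by apply: leq_sum => i _; exact: ltnW.
have mm : 0 < m%:R ^+ d :> R by rewrite exprn_gt0// ltr0n.
rewrite -(ler_pM2l mm) mulrDr mulVKf ?gt_eqF//.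
have -> : m%:R ^+ d * sqnorm f = \sum_(w : {ffun 'I_d -> 'I_m}) sqnorm f.
  by rewrite sumr_const card_ffun !card_ord -natrX mulr_natl.
apply: le_trans (ler_sum _ (fun w _ => each w)) _.
rewrite big_split/= sumr_const card_ffun !card_ord -[X in X + _]mulr_natl natrX lerD2l.
have fsn := fin_supp_norm fs.
rewrite -zsum_sum => [|w]; last exact/fin_supp_mull.
rewrite expr2 -zsumZ; apply: ler_zsum.
- by apply: fin_supp_sum => w; exact/fin_supp_mull.
- exact: fin_supp_mulr.
move=> x; rewrite -mulr_sumr mulrC ler_wpM2r//.
apply: (@sum_inj_le_zsum _ _ _ (fun w => x + pt w) (fun x => `|f x|)) => //.
by move=> v w /addrI/ptI.
Qed.
End Nash.

(** * The quadratic form of the Anderson operator *)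

Section AndersonForm.
Variables (R : realType) (d : nat).
Local Notation Z := 'rV[int]_d.
Local Notation u_ := (@unit_vec d).

Lemma l1norm_eq1 (z : Z) : l1norm z = 1 <-> exists i, z = u_ i \/ z = - u_ i.
Proof.
split=> [z1|[i zi]]; last first.
  have -> : l1norm z = l1norm (u_ i).
    by case: zi => -> //; apply: eq_bigr => j _; rewrite mxE normrN.
  rewrite /l1norm (bigD1 i)//= mxE !eqxx normr1 big1 ?addr0// => j ji.
  by rewrite mxE (negPf ji) normr0.
have [i zi] : exists i, z ord0 i != 0.
  apply/existsP; apply: contraPT (z1) => /existsPn z0.
  by rewrite /l1norm big1// => i _; move: (z0 i); rewrite negbK => /eqP ->.
have := z1; rewrite /l1norm (bigD1 i)//=.
have zi1 : 1 <= `|z ord0 i| by rewrite -gtz0_ge1 normr_gt0.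
set rest := \sum_(j < d | _) _ => zrest.
have rest0 : 0 <= rest by rewrite sumr_ge0.
have r0 : rest = 0 by lia.
have zi' : `|z ord0 i| = 1 by lia.
have zj j : j != i -> z ord0 j = 0.
  move=> ji; apply/eqP; rewrite -normr_eq0.
  by move/eqP: r0; rewrite psumr_eq0// => /allP/(_ j (mem_index_enum j)); rewrite ji.
exists i; move/eqP: zi'; rewrite eqr_norml ler01 andbT => /orP[]/eqP zi'.
  left; apply/rowP => j; rewrite mxE eqxx/=.
  by case: eqP => [->|/eqP /zj ->] //.
right; apply/rowP => j; rewrite !mxE eqxx/=.
by case: eqP => [->|/eqP /zj ->] //.
Qed.

Lemma unit_vec_inj : injective u_.
Proof.
move=> i j /rowP/(_ i); rewrite !mxE !eqxx/=.
by case: (eqVneq i j).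
Qed.

Lemma unit_vec_neqN i j : u_ i <> - u_ j.
Proof.
move=> /rowP/(_ i); rewrite !mxE !eqxx/=.
by case: (eqVneq i j).
Qed.

Lemma sum_neighbors (F : Z -> R) x :
  \sum_(y \in neighbors x) F y = \sum_i (F (x + u_ i) + F (x - u_ i)).
Proof.
pose r := [seq x + u_ i | i : 'I_d] ++ [seq x - u_ i | i : 'I_d].
have rP y : (y \in r) <-> neighbors x y.
  rewrite /neighbors/= l1norm_eq1 mem_cat; split.
    by move=> /orP[]/mapP[i _ ->]; exists i; rewrite addrAC subrr add0r; [left|right].
  move=> [i [] yi]; apply/orP; [left|right]; apply/mapP; exists i; rewrite ?mem_enum//.
    by rewrite -yi addrC subrK.
  by rewrite -yi addrC subrK.
have ur : uniq r.
  rewrite cat_uniq !map_inj_uniq ?enum_uniq//=; last 2 first.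
  - by move=> i j /addrI/oppr_inj/unit_vec_inj.
  - by move=> i j /addrI/unit_vec_inj.
  rewrite -enumT enum_uniq andbT/=.
  apply/hasPn => y /mapP[i _ ->]; apply/negP => /mapP[j _].
  by move=> /addrI/esym; exact: unit_vec_neqN.
rewrite (_ : neighbors x = [set` r]); last by apply/seteqP; split=> y /rP.
rewrite -fsbig_seq//.
rewrite big_cat !big_map/= big_split/=.
by congr (_ + _); rewrite big_enum.
Qed.

Lemma lattice_laplacianE (F : Z -> R) x :
  lattice_laplacian F x = \sum_i (F (x + u_ i) + F (x - u_ i) - F x *+ 2).
Proof.
rewrite /lattice_laplacian sum_neighbors; apply: eq_bigr => i _.
by rewrite addrACA -opprD mulr2n.
Qed.

Definition gradient_form (F G : Z -> R) : R :=
  \sum_i zsum (fun x => (F (x + u_ i) - F x) * (G (x + u_ i) - G x)).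

Lemma gradient_formC F G : gradient_form F G = gradient_form G F.
Proof.
apply: eq_bigr => i _; congr zsum; apply/funext => x; exact: mulrC.
Qed.

(** Discrete summation by parts, by translation invariance of [zsum]. *)
Lemma laplacian_form (F G : Z -> R) : fin_supp F -> fin_supp G ->
  zsum (fun x => - lattice_laplacian F x * G x) = gradient_form F G.
Proof.
move=> fF fG; pose L i x := F (x + u_ i) * G x.
pose L' i x := F (x - u_ i) * G x.
have -> : (fun x => - lattice_laplacian F x * G x) =
    fun x => \sum_i ((2 * (F x * G x) - L i x) - L' i x).
  apply/funext => x; rewrite lattice_laplacianE -sumrN mulr_suml.
  by apply: eq_bigr => i _; rewrite /L /L'; ring.
have fs0 i : fin_supp (fun x => 2 * (F x * G x) - L i x).
  apply: fin_supp_add; first exact/fin_supp_mulr/fin_supp_mulr.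
  exact/fin_supp_opp/fin_supp_mulr.
have fs1 i : fin_supp (L' i) by exact: fin_supp_mulr.
rewrite zsum_sum => [|i]; last first.
  by apply: fin_supp_add => //; exact: fin_supp_opp.
apply: eq_bigr => i _.
rewrite zsumB// -(zsum_shift (L' i) (u_ i)) zsumB//; last 2 first.
- exact/fin_supp_mulr/fin_supp_mulr.
- exact: fin_supp_mulr.
have fFG : fin_supp (fun x => F x * G x) by exact: fin_supp_mulr.
have fFGs : fin_supp (fun x => F (x + u_ i) * G (x + u_ i)).
  exact: (fin_supp_shift (u_ i) fFG).
have fL' : fin_supp (fun x => F x * G (x + u_ i)) by exact: fin_supp_mull.
have -> : (fun x => (F (x + u_ i) - F x) * (G (x + u_ i) - G x)) =
   fun x => F (x + u_ i) * G (x + u_ i) + F x * G x - L i x - F x * G (x + u_ i).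
  by apply/funext => x; rewrite /L; ring.
rewrite zsumB//; last first.
  apply: fin_supp_add; first exact: fin_supp_add.
  exact/fin_supp_opp/fin_supp_mulr.
rewrite zsumB//; last 2 first.
- exact: fin_supp_add.
- exact: fin_supp_mulr.
rewrite zsumD// (zsum_shift (fun x => F x * G x)) zsumZ.
have -> : (fun x => L' i (x + u_ i)) = fun x => F x * G (x + u_ i).
  by apply/funext => x; rewrite /L' addrK.
by rewrite mulr2n mulrDl mul1r.
Qed.

Variable S : {fset Z}.
Local Notation V := {ffun S -> R^o}.
Implicit Types (f g : V) (xi : S -> R).

Lemma extend0_val f (x : S) : extend0 f (val x) = f x.
Proof. by rewrite /extend0 valK. Qed.

Lemma extend0_out f x : x \notin S -> extend0 f x = 0.
Proof. by move=> xS; rewrite /extend0 insubF//; apply: negbTE. Qed.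

Lemma fin_supp_extend0 f : fin_supp (extend0 f).
Proof. by exists S => x /extend0_out ->. Qed.

Lemma sum_site_zsum (G : Z -> R) : (forall x, x \notin S -> G x = 0) ->
  \sum_(x : S) G (val x) = zsum G.
Proof. by move=> G0; rewrite (zsumE G0) big_seq_fsetE. Qed.

Lemma dot_zsum f g : dot f g = zsum (fun x => extend0 f x * extend0 g x).
Proof.
rewrite -sum_site_zsum => [|x xS]; last by rewrite extend0_out ?mul0r.
by apply: eq_bigr => x _; rewrite !extend0_val.
Qed.

Lemma dot_sqnorm f : dot f f = sqnorm (extend0 f).
Proof. by rewrite dot_zsum; congr zsum; apply/funext => x; rewrite expr2. Qed.

Lemma anderson_form e xi f g :
  dot (linfun (anderson e xi) f) g =
  e ^- 2 * gradient_form (extend0 f) (extend0 g) + \sum_x xi x * (f x * g x).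
Proof.
rewrite lfunE -laplacian_form; [|exact: fin_supp_extend0..].
rewrite -sum_site_zsum => [|x xS]; last by rewrite [extend0 g x]extend0_out ?mulr0.
rewrite mulr_sumr -big_split; apply: eq_bigr => x _ /=.
by rewrite ffunE extend0_val; ring.
Qed.

Lemma anderson_sym e xi f g :
  dot (linfun (anderson e xi) f) g = dot f (linfun (anderson e xi) g).
Proof.
rewrite [RHS]dotC !anderson_form gradient_formC; congr (_ + _).
by apply: eq_bigr => x _; rewrite [f x * _]mulrC.
Qed.

Lemma anderson_quad e xi f :
  dot f (linfun (anderson e xi) f) =
  e ^- 2 * energy (extend0 f) + \sum_x xi x * f x ^+ 2.
Proof. by rewrite dotC anderson_form. Qed.

Lemma energy_le_sqnorm (F : Z -> R) : fin_supp F -> energy F <= (4 * d)%:R * sqnorm F.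
Proof.
move=> fF; rewrite mulnC natrM -mulrA mulr_natl -{3}(card_ord d) -sumr_const.
apply: ler_sum => i _; have fF2 := fin_supp_sqr fF.
have -> : 4 * sqnorm F = 2 * sqnorm F + 2 * sqnorm F by ring.
rewrite {1}/sqnorm -(zsum_shift (fun x => F x ^+ 2) (u_ i)) -!zsumZ -zsumD; last 2 first.
- exact/fin_supp_mulr/(fin_supp_shift (u_ i) fF2).
- exact: fin_supp_mulr.
apply: ler_zsum.
- exact/fin_supp_sqr/fin_supp_shiftB.
- apply: fin_supp_add; last exact: fin_supp_mulr.
  exact/fin_supp_mulr/(fin_supp_shift (u_ i) fF2).
move=> x; move: (F (x + u_ i)) (F x) => a b; rewrite -subr_ge0.
suff -> : 2 * a ^+ 2 + 2 * b ^+ 2 - (a - b) ^+ 2 = (a + b) ^+ 2 by exact: sqr_ge0.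
by ring.
Qed.

End AndersonForm.

(** * A killed random walk and its heat kernel *)

(** At scale [m] the recursion pulls [N] towards [m ^- d] at rate
    [kappa / m ^ 2].  When the scale doubles, the excess over the new target is
    at most [2 ^ d.+1] times that target, and [L * (2 m) ^ 2] steps reduce it to
    the target.  The numbers of steps form a geometric series, so reaching
    scale [m] takes [O(m ^ 2)] steps; using the final scale from the start would
    cost an additional logarithm. *)
Lemma dyadic_decay (R : realType) (d : nat) (kappa : R) (L : nat) (N : nat -> R) :
    0 <= kappa <= 1 -> expR (- (kappa * L%:R)) <= 2 ^- d.+1 ->
    N 0%N <= 1 -> (forall n, N n.+1 <= N n) ->
    (forall m n, (0 < m)%N ->
      N n.+1 - m%:R ^- d <= (1 - kappa / m%:R ^+ 2) * (N n - m%:R ^- d)) ->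
  forall j, N (2 * L * 4 ^ j)%N <= 2 * (2 ^+ j) ^- d.
Proof.
move=> /andP[k0 k1] eL N0 Nni step.
have Nmono m n : (m <= n)%N -> N n <= N m.
  by move=> mn; apply: (nonincreasing_seqP N).1 => // i; exact: Nni.
elim=> [|j IH].
  rewrite expr0 expr1n invr1 mulr1.
  by rewrite (le_trans (Nmono _ _ (leq0n _)))// (le_trans N0)// ler1n.
pose m := (2 ^ j.+1)%N; pose q : R := m%:R ^- d; pose r := 1 - kappa / m%:R ^+ 2.
have m0 : (0 < m)%N by rewrite expn_gt0.
have mR : 0 < m%:R :> R by rewrite ltr0n.
have q0 : 0 < q by rewrite invr_gt0 exprn_gt0.
have r0 : 0 <= r.
  rewrite subr_ge0 ler_pdivrMr ?exprn_gt0// mul1r (le_trans k1)//.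
  by rewrite exprn_ege1// ler1n.
have geo n t : N (n + t)%N - q <= r ^+ t * (N n - q).
  elim: t => [|t IHt]; first by rewrite addn0 expr0 mul1r.
  rewrite addnS (le_trans (step _ _ m0))// [r ^+ t.+1]exprS -[leRHS]mulrA.
  by rewrite ler_wpM2l.
set n0 := (2 * L * 4 ^ j)%N in IH.
have jq : 2 * (2 ^+ j) ^- d = 2 ^+ d.+1 * q.
  have -> : q = (2 ^+ j) ^- d * 2 ^- d.
    by rewrite /q /m natrX [2 ^+ j.+1]exprSr exprMn invfM.
  rewrite exprS -mulrA; congr (_ * _); rewrite mulrCA divff ?mulr1//.
have r_exp : r ^+ (L * 4 ^ j.+1) <= 2 ^- d.+1.
  apply: le_trans eL.
  have re : r <= expR (- (kappa / m%:R ^+ 2)) by exact: expR_ge1Dx.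
  apply: (le_trans (lerXn2r _ _ _ re)); rewrite ?nnegrE ?expR_ge0//.
  rewrite -expRM_natl ler_expR mulrN lerN2.
  have -> : m%:R ^+ 2 = (4 ^ j.+1)%:R :> R by rewrite /m -natrX -expnM mulnC expnM.
  have c0 : (4 ^ j.+1)%:R != 0 :> R by rewrite pnatr_eq0 expn_eq0.
  by rewrite natrM -mulrA [_ * (kappa / _)]mulrC divfK// mulrC.
have := geo n0 (L * 4 ^ j.+1)%N.
have -> : 2 * (2 ^+ j.+1) ^- d = q + q by rewrite -natrX -/m -/q; ring.
rewrite lerBlDr => /(le_trans (Nmono _ _ _)) => /(_ (2 * L * 4 ^ j.+1)%N) H.
apply: le_trans (H _) _.
  rewrite /n0 -[leqRHS]mulnA [leqRHS]mul2n -addnn leq_add2r expnS (mulnCA L 4) -mulnA.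
  by rewrite leq_mul2r orbT.
rewrite lerD2r; have [Nq|qN] := lerP (N n0 - q) 0.
  by apply: le_trans (ltW q0); rewrite mulr_ge0_le0// exprn_ge0.
apply: (@le_trans _ _ (2 ^- d.+1 * (2 ^+ d.+1 * q))); last first.
  by rewrite mulKf// expf_neq0.
apply: ler_pM => //; first exact: exprn_ge0.
  exact: ltW.
by rewrite -jq (le_trans _ IH)// gerBl ltW.
Qed.

Section Decay.
Variables (R : realType) (d : nat) (S : {fset 'rV[int]_d}).
Local Notation Z := 'rV[int]_d.
Local Notation V := {ffun S -> R^o}.
Local Notation u_ := (@unit_vec d).
Variables (a b e p : R) (xi : S -> R).
Hypotheses (e01 : 0 < e < 1) (p0 : 0 < p).
Hypothesis p1 : p * ((4 * d)%:R + (b - a)) <= 1.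
Hypothesis xi_ab : forall x, a <= xi x <= b.

Local Notation H := (linfun (anderson e xi)).
Local Notation dl := (p * e ^+ 2).

(** The operator [1 - p e ^ 2 (H - a)]: one step of a lazy random walk killed
    outside [S] and by the potential.  The bound assumed on [p] makes its matrix
    nonnegative and its quadratic form lie between 0 and 1. *)
Definition markov_step (u : V) : V := u - dl *: (H u - a *: u).

Lemma markov_stepE u x : markov_step u x =
  (1 - (2 * d)%:R * p - dl * (xi x - a)) * u x +
  p * \sum_i (extend0 u (val x + u_ i) + extend0 u (val x - u_ i)).
Proof.
have /andP[e0 _] := e01.
rewrite !ffunE /= lfunE/= ffunE lattice_laplacianE extend0_val.
rewrite sumrB sumr_const card_ord.
set s := \sum_i _; rewrite -mulr_natr -[u x *+ 2]mulr_natr natrM /GRing.scale/=.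
field.
by rewrite gt_eqF.
Qed.

Implicit Types u v : V.

Let e0 : 0 < e. Proof. by have /andP[] := e01. Qed.
Let e2 : e ^+ 2 <= 1.
Proof. by rewrite expr_le1// ltW//; have /andP[] := e01. Qed.
Let dl0 : 0 <= dl. Proof. by rewrite mulr_ge0 ?sqr_ge0// ltW. Qed.

Lemma diagonal_weight x : 0 <= 1 - (2 * d)%:R * p - dl * (xi x - a).
Proof.
have /andP[ax xb] := xi_ab x.
rewrite subr_ge0 (@le_trans _ _ (p * (b - a)))//.
  rewrite -mulrA ler_wpM2l ?(ltW p0)// -[leRHS]mul1r.
  by rewrite ler_pM ?sqr_ge0 ?subr_ge0// lerD2r.
rewrite lerBrDr; apply: le_trans p1; rewrite [leRHS]mulrDr addrC lerD2r mulrC.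
by rewrite ler_wpM2l ?(ltW p0)// ler_nat leq_mul2r orbT.
Qed.

Lemma extend0_ge0 (u : V) y : (forall x, 0 <= u x) -> 0 <= extend0 u y.
Proof.
by move=> u0; rewrite /extend0; case: insubP => [z _ _|_] /=; [exact: u0|exact: lexx].
Qed.

Lemma markov_step_ge0 u : (forall x, 0 <= u x) -> forall x, 0 <= markov_step u x.
Proof.
move=> u0 x; rewrite markov_stepE addr_ge0 ?mulr_ge0 ?diagonal_weight// ?(ltW p0)//.
by apply: sumr_ge0 => i _; rewrite addr_ge0// extend0_ge0.
Qed.

Lemma sum_extend0 u : \sum_x u x = zsum (extend0 u).
Proof.
rewrite -(sum_site_zsum (S := S)) => [|x xS]; last by rewrite extend0_out.
by apply: eq_bigr => x _; rewrite extend0_val.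
Qed.

Lemma sum_markov_step u : (forall x, 0 <= u x) ->
  \sum_x markov_step u x <= \sum_x u x.
Proof.
move=> u0; have fu := fin_supp_extend0 u.
have neighbor_sum h : \sum_(x : S) extend0 u (val x + h) <= \sum_x u x.
  rewrite sum_extend0 -(zsum_shift _ h).
  apply: (@sum_inj_le_zsum _ _ _ val (fun x => extend0 u (x + h))).
  - exact: val_inj.
  - exact: fin_supp_shift.
  - by move=> x; exact: extend0_ge0.
have le1 x : markov_step u x <= (1 - (2 * d)%:R * p) * u x +
    p * \sum_i (extend0 u (val x + u_ i) + extend0 u (val x - u_ i)).
  rewrite markov_stepE lerD2r ler_wpM2r// gerBl mulr_ge0// subr_ge0.
  by have /andP[] := xi_ab x.
apply: le_trans (ler_sum _ (fun x _ => le1 x)) _.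
rewrite big_split/= -!mulr_sumr exchange_big/=.
rewrite mulrBl mul1r -addrA gerDl addrC subr_le0.
rewrite [(2 * d)%:R * p]mulrC -mulrA ler_wpM2l ?(ltW p0)//.
have -> : (2 * d)%:R * \sum_x u x = \sum_(i < d) (\sum_x u x + \sum_x u x).
  by rewrite sumr_const card_ord -mulr2n -mulrnA mulr_natl.
by apply: ler_sum => i _; rewrite big_split/= lerD.
Qed.

Lemma markov_stepB u v : markov_step (u - v) = markov_step u - markov_step v.
Proof.
have subACA (x y z t : V) : x - y - (z - t) = x - z - (y - t).
  by rewrite opprD addrACA -opprD.
by rewrite /markov_step [H (u - v)]linearB (scalerBr a) (subACA (H u)) scalerBr subACA.
Qed.

Lemma dot_markov_step u v : dot (markov_step u) v = dot u (markov_step v).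
Proof.
by rewrite /markov_step !(dotBl, dotBr, dotZl, dotZr) anderson_sym.
Qed.

Lemma generator_form u : dot u u - dot u (markov_step u) =
  p * energy (extend0 u) + dl * \sum_x (xi x - a) * u x ^+ 2.
Proof.
rewrite /markov_step !(dotBr, dotZr) anderson_quad.
have -> : \sum_x (xi x - a) * u x ^+ 2 = \sum_x xi x * u x ^+ 2 - a * dot u u.
  rewrite mulr_sumr -sumrB; apply: eq_bigr => x _; rewrite mulrBl expr2; ring.
have -> : p * energy (extend0 u) = dl * (e ^- 2 * energy (extend0 u)).
  by rewrite -mulrA mulVKf// expf_neq0// gt_eqF.
by ring.
Qed.

Lemma potential_form_ge0 u : 0 <= \sum_x (xi x - a) * u x ^+ 2.
Proof.
apply: sumr_ge0 => x _; rewrite mulr_ge0 ?sqr_ge0// subr_ge0.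
by have /andP[] := xi_ab x.
Qed.

Lemma energy_dissipation u :
  p * energy (extend0 u) <= dot u u - dot u (markov_step u).
Proof. by rewrite generator_form lerDl mulr_ge0// potential_form_ge0. Qed.

(** [H - a] is bounded by [e ^- 2] times [4 d + b - a]. *)
Lemma markov_step_form_ge0 u : 0 <= dot u (markov_step u).
Proof.
suff : dot u u - dot u (markov_step u) <= dot u u by rewrite gerBl.
rewrite generator_form.
apply: (@le_trans _ _ (p * ((4 * d)%:R + (b - a)) * dot u u)); last first.
  by rewrite ler_piMl ?dot_ge0.
rewrite -[leRHS]mulrA [X in _ <= p * X]mulrDl [leRHS]mulrDr; apply: lerD.
  rewrite ler_wpM2l ?(ltW p0)// dot_sqnorm energy_le_sqnorm//.
  exact: fin_supp_extend0.
rewrite -mulrA ler_wpM2l ?(ltW p0)// -[leRHS]mul1r ler_pM ?sqr_ge0 ?potential_form_ge0//.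
rewrite mulr_sumr; apply: ler_sum => x _; rewrite -expr2 ler_wpM2r ?sqr_ge0//.
by have /andP[] := xi_ab x => _ xb; rewrite lerD2r.
Qed.

(** [A ^ 2 <= A] whenever [0 <= A <= 1]: expand the form of [A] at [u - A u]. *)
Lemma markov_step_sq u : dot (markov_step u) (markov_step u) <= dot u (markov_step u).
Proof.
set v := markov_step u.
have := markov_step_form_ge0 (u - v).
have e1 : dot u (markov_step v) = dot v v by rewrite -dot_markov_step.
have : 0 <= p * energy (extend0 v) by rewrite mulr_ge0 ?energy_ge0// ltW.
have := energy_dissipation v; rewrite markov_stepB -/v.
move: (markov_step v) e1 => w; clearbody v => e1; rewrite !(dotBl, dotBr) e1; lra.
Qed.

End Decay.

Lemma dot_cauchy (R : realType) (I : finType) (f g : {ffun I -> R^o}) :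
  dot f g ^+ 2 <= dot f f * dot g g.
Proof.
have [g0|g0] := eqVneq (dot g g) 0.
  have /eqP -> : g == 0 by rewrite -dot_eq0 g0.
  by rewrite !dot0r expr0n mulr0.
have gg : 0 < dot g g by rewrite lt_def g0 dot_ge0.
have := dot_ge0 (dot g g *: f - dot f g *: g).
rewrite !(dotBl, dotBr, dotZl, dotZr) (dotC g f).
move: (dot f f) (dot f g) (dot g g) gg => x y z z0 H.
rewrite -subr_ge0 -(pmulr_rge0 _ z0).
suff -> : z * (x * z - y ^+ 2) =
  z * (z * x - y * y) - (y * (z * y - y * z)) by lra.
by ring.
Qed.

Section HeatKernel.
Variables (R : realType) (d : nat) (S : {fset 'rV[int]_d}).
Local Notation V := {ffun S -> R^o}.
Variables (a b e p : R) (xi : S -> R).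
Hypotheses (d0 : (0 < d)%N) (e01 : 0 < e < 1) (ab : a <= b) (p0 : 0 < p).
Hypothesis p1 : p * ((4 * d)%:R + (b - a)) <= 1.
Hypothesis xi_ab : forall x, a <= xi x <= b.

Local Notation H := (linfun (anderson e xi)).
Local Notation dl := (p * e ^+ 2).
Local Notation A := (markov_step a e p xi).
Local Notation ind x := (site_indicator R x : V).

Lemma iter_markov_ge0 n x y : 0 <= iter n A (ind x) y.
Proof.
elim: n y => [|n IH] y; first by rewrite ffunE ler0n.
by rewrite iterS; apply: (markov_step_ge0 e01 p0 p1 xi_ab).
Qed.

Lemma sum_iter_markov n x : \sum_y iter n A (ind x) y <= 1.
Proof.
elim: n => [|n IH].
  rewrite (bigD1 x)//= ffunE eqxx big1 ?addr0// => y yx.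
  by rewrite ffunE (negPf yx).
rewrite iterS (le_trans _ IH)//.
apply: (sum_markov_step e01 p0 xi_ab) => y; exact: iter_markov_ge0.
Qed.

Lemma dot_iter_markov n f g : dot (iter n A f) g = dot f (iter n A g).
Proof.
elim: n f g => [//|n IH] f g.
by rewrite iterS (dot_markov_step a e p xi) IH -iterSr.
Qed.

Let N x n := dot (iter n A (ind x)) (iter n A (ind x)).

Lemma energy_drop x n :
  N x n.+1 <= N x n - p * energy (extend0 (iter n A (ind x))).
Proof.
rewrite /N !iterS lerBrDr.
have := energy_dissipation e01 p0 xi_ab (iter n A (ind x)).
have := markov_step_sq e01 p0 p1 xi_ab (iter n A (ind x)).
lra.
Qed.

(** As the mass of the walk is at most 1, the Nash inequality bounds from below
    the energy dissipated in one step. *)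
Lemma heat_contraction x m n : (0 < m)%N ->
  N x n.+1 - m%:R ^- d <=
  (1 - (2 * p / d%:R ^+ 2) / m%:R ^+ 2) * (N x n - m%:R ^- d).
Proof.
move=> m0; set u := iter n A (ind x).
have fu := fin_supp_extend0 u.
have dm0 : 0 < (d * m)%:R ^+ 2 :> R by rewrite exprn_gt0// ltr0n muln_gt0 d0.
have l1 : zsum (fun y => `|extend0 u y|) ^+ 2 <= 1.
  rewrite expr_le1//; last by apply: zsum_ge0 => y.
  apply: le_trans (sum_iter_markov n x); rewrite sum_extend0.
  apply: ler_zsum => //; first exact: fin_supp_norm.
  by move=> y; rewrite ger0_norm// extend0_ge0//; exact: iter_markov_ge0.
have := nash fu m0; rewrite -dot_sqnorm -/(N x n).
have := energy_drop x n; rewrite -/u.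
set En := energy _ => drop.
set q := m%:R ^- d; have q0 : 0 <= q by rewrite invr_ge0 exprn_ge0.
move=> ns.
have {}ns : N x n - q <= (d * m)%:R ^+ 2 / 2 * En.
  rewrite lerBlDr (le_trans ns)// lerD2l ler_piMr//.
have {}ns : 2 * p / d%:R ^+ 2 / m%:R ^+ 2 * (N x n - q) <= p * En.
  have -> : 2 * p / d%:R ^+ 2 / m%:R ^+ 2 = p / ((d * m)%:R ^+ 2 / 2).
    by rewrite natrM; field; rewrite !pnatr_eq0 -!lt0n d0 m0.
  rewrite -mulrA ler_wpM2l ?(ltW p0)// -ler_pdivlMl ?invr_gt0 ?divr_gt0//.
  by rewrite invrK.
by rewrite mulrBl mul1r; lra.
Qed.

Lemma heat_decay (L : nat) x j :
  expR (- (2 * p / d%:R ^+ 2 * L%:R)) <= 2 ^- d.+1 ->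
  N x (2 * L * 4 ^ j)%N <= 2 * (2 ^+ j) ^- d.
Proof.
move=> HL; apply: (@dyadic_decay _ _ (2 * p / d%:R ^+ 2) L (N x)) => //.
- rewrite divr_ge0 ?mulr_ge0 ?(ltW p0)// ler_pdivrMr ?exprn_gt0 ?ltr0n// mul1r.
  have d1 : 1 <= d%:R :> R by rewrite ler1n.
  have : p * (4 * d)%:R <= 1.
    by apply: le_trans p1; rewrite ler_wpM2l ?(ltW p0)// lerDl subr_ge0.
  rewrite natrM; nra.
- rewrite /N /= dot_delta ffunE eqxx; exact: lexx.
- move=> n; apply: (le_trans (energy_drop x n)).
  by rewrite gerBl mulr_ge0 ?energy_ge0// ltW.
- by move=> m n; exact: heat_contraction.
Qed.

(** Write [f = A ^ n h]; then [f x] is the scalar product of [h] with the heat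
    kernel from [x], and both factors are under control when [n] is of order
    [e ^- 2]. *)
Lemma sup_bound (L : nat) (K : R) s f x :
    expR (- (2 * p / d%:R ^+ 2 * L%:R)) <= 2 ^- d.+1 ->
    a <= K -> p * (K - a) <= 2^-1 -> uniq s -> {in s, forall r, r <= K} ->
    f \in (\sum_(r <- s) passmx.leigenspace H r)%VS ->
  f x ^+ 2 <= 2 * expR (8 * L%:R * p * (K - a)) * (2 * e) ^+ d * dot f f.
Proof.
move=> HL aK pK us sK fE; have /andP[e0 e1] := e01.
(* the diffusive scale [2 ^ j] of the walk is matched with [e^-1] *)
have [j /andP[je ej]] : exists j : nat, 2 ^+ j <= e^-1 < 2 ^+ j.+1.
  pose Q := fun j : nat => e^-1 < 2 ^+ j.
  have exQ : exists j, Q j.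
    exists (Num.truncn e^-1).+1; rewrite /Q (lt_trans (truncnS_gt _))//.
    by rewrite -natrX ltr_nat ltn_expl.
  case: (ex_minnP exQ) => -[|j] Qj min.
    by move: Qj; rewrite /Q expr0 ltNge invf_ge1// ltW.
  exists j; rewrite [X in _ && X]Qj andbT leNgt; apply/negP => /min.
  by rewrite ltnn.
set n := (2 * L * 4 ^ j)%N.
pose th := 1 - dl * (K - a).
have dl_le : dl * (K - a) <= 2^-1.
  apply: le_trans pK; rewrite ler_wpM2r ?subr_ge0// ler_piMr ?(ltW p0)//.
  by rewrite expr_le1// ltW.
have dlK0 : 0 <= dl * (K - a).
  by rewrite mulr_ge0 ?subr_ge0// mulr_ge0 ?sqr_ge0// ltW.
have th0 : 0 < th.
  by rewrite subr_gt0 (le_lt_trans dl_le)// invf_lt1// ltr1n.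
have symH f1 g1 := @anderson_sym R d S e xi f1 g1.
have [|h [hf hh]] := inverse_iterate symH n us sK _ th0 fE.
  by rewrite mulr_ge0 ?sqr_ge0// ltW.
have fx : f x = dot h (iter n A (ind x)).
  by rewrite -dot_iter_markov -dot_delta -hf.
have Nn := heat_decay x j HL; rewrite -/n in Nn.
have f2 : th ^+ (2 * n) * f x ^+ 2 <= dot f f * (2 * (2 * e) ^+ d).
  rewrite fx; apply: (@le_trans _ _ (th ^+ (2 * n) * (dot h h * N x n))).
    by rewrite ler_wpM2l ?exprn_ge0 ?(ltW th0)// dot_cauchy.
  rewrite [leLHS]mulrA; apply: ler_pM => //.
  - by rewrite mulr_ge0 ?dot_ge0 ?exprn_ge0 ?(ltW th0).
  - exact: dot_ge0.
  rewrite (le_trans Nn)// ler_wpM2l// -exprVn lerXn2r ?nnegrE ?invr_ge0 ?exprn_ge0//.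
    by rewrite mulr_ge0// ltW.
  rewrite -[leRHS]invrK lef_pV2 ?posrE ?invr_gt0 ?mulr_gt0 ?exprn_gt0//.
  by rewrite invfM mulrC ler_pdivrMr// -exprSr ltW.
have the : expR (- (8 * L%:R * p * (K - a))) <= th ^+ (2 * n).
  have th_exp : expR (- (2 * (dl * (K - a)))) <= th.
    move: (dl * (K - a)) dlK0 dl_le @th {th0 hh f2} => y y0 y1 th.
    rewrite /th expRN -div1r ler_pdivrMr ?expR_gt0//.
    apply: (@le_trans _ _ ((1 - y) * (1 + 2 * y))); first by nra.
    by rewrite ler_wpM2l ?expR_ge1Dx//; lra.
  apply: (@le_trans _ _ (expR (- (2 * (dl * (K - a)))) ^+ (2 * n))); last first.
    by rewrite lerXn2r ?nnegrE ?expR_ge0// ltW.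
  rewrite -expRM_natl ler_expR mulrN lerN2.
  have ne : (4 ^ j)%:R * e ^+ 2 <= 1.
    have -> : (4 ^ j)%:R = (2 ^+ j) ^+ 2 :> R by rewrite -natrX -natrX -expnM mulnC expnM.
    rewrite -exprMn expr_le1 ?mulr_ge0 ?exprn_ge0 ?(ltW e0)//.
    by rewrite -ler_pdivlMr// div1r.
  have -> : (2 * n)%:R * (2 * (dl * (K - a))) =
      8 * L%:R * p * (K - a) * ((4 ^ j)%:R * e ^+ 2).
    by rewrite /n !natrM; ring.
  by rewrite ler_piMr// !mulr_ge0 ?subr_ge0// ltW.
have the0 := expR_gt0 (- (8 * L%:R * p * (K - a))).
rewrite -(ler_pM2l the0); apply: (@le_trans _ _ (th ^+ (2 * n) * f x ^+ 2)).
  by rewrite ler_wpM2r ?sqr_ge0.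
apply: (le_trans f2).
have : expR (- (8 * L%:R * p * (K - a))) * expR (8 * L%:R * p * (K - a)) = 1.
  by rewrite -expRD addNr expR0.
set c := 8 * _ * _ * _; move: (expR (- c)) (expR c) => E E' EE'.
rewrite (_ : E * _ = E * E' * (dot f f * (2 * (2 * e) ^+ d))); last by ring.
by rewrite EE' mul1r.
Qed.

End HeatKernel.

(** A normalized vector of bounded energy obeys the sup bound of the heat kernel
    at a macroscopic time of order 1. *)
Lemma delocalization (R : realType) (d : nat) (a b K : R) :
    (0 < d)%N -> a <= b -> a <= K ->
  exists C : R, 0 < C /\ forall (S : {fset 'rV[int]_d}) (e : R) (xi : S -> R) s f x,
    0 < e < 1 -> (forall x, a <= xi x <= b) -> uniq s -> {in s, forall r, r <= K} ->
    f \in (\sum_(r <- s) passmx.leigenspace (linfun (anderson e xi)) r)%VS ->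
    f x ^+ 2 <= C * e ^+ d * dot f f.
Proof.
move=> d0 ab aK.
have d1 : 1 <= d%:R :> R by rewrite ler1n.
(* [1 / D] meets both demands on [p]: the first two terms make the step a
   contraction with nonnegative entries, the last one keeps its eigenvalues
   at low energy above [1 / 2] *)
pose D : R := (4 * d)%:R + (b - a) + 2 * (K - a).
have D0 : 0 < D.
  by rewrite /D natrM; lra.
pose p := D^-1; have p0 : 0 < p by rewrite invr_gt0.
pose kap := 2 * p / d%:R ^+ 2.
have kap0 : 0 < kap by apply: divr_gt0; [rewrite mulr_gt0|rewrite exprn_gt0// ltr0n].
pose L := (Num.truncn (d.+1%:R * 2 / kap)).+1.
have HL : expR (- (kap * L%:R)) <= 2 ^- d.+1.
  rewrite expRN lef_pV2 ?posrE ?expR_gt0 ?exprn_gt0//.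
  apply: (@le_trans _ _ (expR (d.+1%:R * 2))).
    rewrite expRM_natl lerXn2r ?nnegrE ?expR_ge0//.
    by apply: le_trans (expR_ge1Dx 2); lra.
  rewrite ler_expR [leRHS]mulrC -ler_pdivrMr// ltW//; exact: truncnS_gt.
exists (2 * expR (8 * L%:R * p * (K - a)) * 2 ^+ d); split.
  by rewrite !mulr_gt0 ?expR_gt0 ?exprn_gt0.
move=> S e xi s f x e01 xi_ab us sK fE.
have := @sup_bound R d S a b e p xi d0 e01 ab p0 _ xi_ab L K s f x HL aK _ us sK fE.
rewrite exprMn !mulrA; apply.
  by rewrite ler_pdivrMl// mulr1 /D; lra.
by rewrite ler_pdivrMl// /D natrM; lra.
Qed.

(** * Perturbation and test functions for the eigenvalues *)

Section Perturbation.
Variables (R : realType) (d : nat) (S : {fset 'rV[int]_d}) (e : R) (k : nat).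
Local Notation V := {ffun S -> R^o}.
Local Notation lam xi := (kth_eigenvalue k (linfun (@anderson R d e S xi))).
Hypothesis kS : (0 < k <= #|{: S}|)%N.

(** The low-energy subspace of the first operator is a test space for the
    second one. *)
Lemma eigenvalue_perturbation (xi xi' : S -> R) (eta : R) :
  (forall s f, uniq s -> {in s, forall r, r <= lam xi} ->
    f \in (\sum_(r <- s) passmx.leigenspace (linfun (anderson e xi)) r)%VS ->
    \sum_x (xi' x - xi x) * f x ^+ 2 <= eta * dot f f) ->
  lam xi' <= lam xi + eta.
Proof.
move=> Hf.
have [s [us sl ks]] := low_eigenspaces (@anderson_sym R d S e xi) kS.
apply: (kth_eigenvalue_le (@anderson_sym R d S e xi') kS ks) => f fE.
have := dot_eigen_sum_op_le (@anderson_sym R d S e xi) us sl fE.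
have := Hf s f us sl fE.
rewrite !anderson_quad mulrDl.
have -> : \sum_x (xi' x - xi x) * f x ^+ 2 =
    \sum_x xi' x * f x ^+ 2 - \sum_x xi x * f x ^+ 2.
  by rewrite -sumrB; apply: eq_bigr => x _; rewrite mulrBl.
lra.
Qed.

Lemma eigenvalue_shift (xi xi' : S -> R) (eta : R) :
  (forall x, xi' x <= xi x + eta) -> lam xi' <= lam xi + eta.
Proof.
move=> H; apply: eigenvalue_perturbation => s f _ _ _.
rewrite mulr_sumr; apply: ler_sum => x _; rewrite -expr2 ler_wpM2r ?sqr_ge0//.
by rewrite lerBlDl.
Qed.

Lemma eigenvalue_lipschitz (xi xi' : S -> R) (eta : R) :
  (forall x, `|xi x - xi' x| <= eta) -> `|lam xi - lam xi'| <= eta.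
Proof.
have le1 xi1 xi2 : (forall x, `|xi1 x - xi2 x| <= eta) -> lam xi1 <= lam xi2 + eta.
  by move=> H; apply: eigenvalue_shift => x; have := H x; rewrite ler_norml; lra.
move=> H; have := le1 _ _ H.
have /le1 : forall x, `|xi' x - xi x| <= eta by move=> x; rewrite distrC.
by move: (lam xi) (lam xi') => y y'; rewrite ler_norml; lra.
Qed.

End Perturbation.

Section TestFunctions.
Variables (R : realType) (d : nat) (S : {fset 'rV[int]_d}) (e b : R) (k : nat).
Local Notation V := {ffun S -> R^o}.
Local Notation Z := 'rV[int]_d.

Lemma sqr_sum_le (a : 'I_k -> R) : (\sum_j a j) ^+ 2 <= k%:R * \sum_j a j ^+ 2.
Proof.
have := dot_cauchy ([ffun j => a j] : {ffun 'I_k -> R^o}) [ffun=> 1].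
set f : {ffun 'I_k -> R^o} := [ffun j => a j]; set g : {ffun 'I_k -> R^o} := [ffun=> 1].
have -> : dot f g = \sum_j a j by apply: eq_bigr => j _; rewrite !ffunE mulr1.
have -> : dot f f = \sum_j a j ^+ 2 by apply: eq_bigr => j _; rewrite !ffunE.
have -> : dot g g = k%:R.
  rewrite -[in RHS](card_ord k) -sumr_const.
  by apply: eq_bigr => j _; rewrite !ffunE mulr1.
by rewrite mulrC.
Qed.

Lemma energy_sum (F : 'I_k -> Z -> R) : (forall j, fin_supp (F j)) ->
  energy (fun x => \sum_j F j x) <= k%:R * \sum_j energy (F j).
Proof.
move=> fF; rewrite /energy exchange_big/= mulr_sumr; apply: ler_sum => i _.
rewrite /shift_sqdist -zsum_sum => [|j]; last first.
  exact/fin_supp_sqr/fin_supp_shiftB.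
rewrite -zsumZ; apply: ler_zsum.
- exact/fin_supp_sqr/fin_supp_shiftB/fin_supp_sum.
- apply/fin_supp_mulr/fin_supp_sum => j; exact/fin_supp_sqr/fin_supp_shiftB.
by move=> x; rewrite -sumrB sqr_sum_le.
Qed.

Lemma energyZ c (F : Z -> R) : energy (fun x => c * F x) = c ^+ 2 * energy F.
Proof.
rewrite /energy mulr_sumr; apply: eq_bigr => i _.
rewrite /shift_sqdist -zsumZ; congr zsum; apply/funext => x.
by rewrite -mulrBr exprMn.
Qed.

(** Min-max on the span of [k] functions with disjoint supports.  Neighbouring
    supports may interact through the gradient; Cauchy-Schwarz accounts for
    this by the factor [k]. *)
Lemma eigenvalue_le_test (xi : S -> R) (F : 'I_k -> Z -> R) (M : R) :
  (0 < k)%N ->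
  (forall x, xi x <= b) ->
  (forall j x, x \notin S -> F j x = 0) ->
  (forall i j x, i != j -> F i x * F j x = 0) ->
  (forall j, 0 < sqnorm (F j)) ->
  (forall j, energy (F j) <= M * sqnorm (F j)) ->
  kth_eigenvalue k (linfun (anderson e xi)) <= e ^- 2 * (k%:R * M) + b.
Proof.
move=> k0 xib F0 Fd Fp FE.
pose f j : V := [ffun x => F j (val x)].
have ef j : extend0 (f j) = F j.
  apply/funext => x; rewrite /extend0; case: insubP => [u _ <-|/F0 ->]//=.
  by rewrite ffunE.
have fF j : fin_supp (F j) by exists S => x /F0.
have fij i j : i != j -> dot (f i) (f j) = 0.
  by move=> ij; rewrite /dot big1// => x _; rewrite !ffunE Fd.
pose X := [tuple f j | j < k].
have Xj (j : 'I_k) : X`_j = f j by rewrite -tnth_nth tnth_mktuple.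
have freeX : free X.
  apply/freeP => c c0 i; have := dot0l (f i); rewrite -c0.
  rewrite (_ : dot _ _ = c i * dot (f i) (f i)).
    by move/eqP; rewrite mulf_eq0 dot_sqnorm ef (gt_eqF (Fp i)) orbF => /eqP.
  transitivity (\sum_j c j * dot (f j) (f i)).
    elim/big_ind2 : _ => [|u v w z <- <-|j _]; rewrite ?dot0l ?dotDl//.
    by rewrite dotZl Xj.
  by rewrite (bigD1 i)//= big1 ?addr0// => j ji; rewrite fij ?mulr0.
have dimX : \dim <<X>>%VS = k by rewrite (eqP freeX) size_tuple.
apply: (kth_eigenvalue_le (@anderson_sym R d S e xi) (W := <<X>>%VS)).
- rewrite k0 -[X in (X <= _)%N]dimX.
  by apply: leq_trans (dimvS (subvf _)) _; rewrite dimvf /dim/= muln1.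
- by rewrite dimX.
move=> g /coord_span gE; pose c j := coord X j g.
have gx : extend0 g = fun x => \sum_j c j * F j x.
  apply/funext => x; rewrite {1}gE.
  have [xS|xS] := boolP (x \in S); last first.
    by rewrite extend0_out// big1// => j _; rewrite F0 ?mulr0.
  rewrite -[x]/(val [` xS]%fset) extend0_val sum_ffunE; apply: eq_bigr => j _.
  by rewrite Xj !ffunE.
have gg : dot g g = \sum_j c j ^+ 2 * sqnorm (F j).
  rewrite dot_sqnorm gx /sqnorm.
  under [RHS]eq_bigr do rewrite -zsumZ.
  rewrite -zsum_sum => [|j]; last exact/fin_supp_mulr/fin_supp_sqr.
  congr zsum; apply/funext => x; rewrite expr2 mulr_suml; apply: eq_bigr => j _.
  rewrite mulr_sumr (bigD1 j)//= big1 ?addr0 => [|i ij]; first by ring.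
  by rewrite mulrACA Fd ?mulr0// eq_sym.
have Eg : energy (extend0 g) <= k%:R * M * dot g g.
  rewrite gx; apply: le_trans (energy_sum _) _ => [j|]; first exact: fin_supp_mulr.
  rewrite -mulrA ler_wpM2l// gg mulr_sumr; apply: ler_sum => j _.
  by rewrite energyZ mulrCA ler_wpM2l ?sqr_ge0.
rewrite anderson_quad mulrDl lerD//.
  by rewrite -mulrA ler_wpM2l ?invr_ge0 ?sqr_ge0.
rewrite mulr_sumr; apply: ler_sum => x _.
by rewrite -expr2 ler_wpM2r ?sqr_ge0.
Qed.

Lemma eigenvalue_le_trivial (xi : S -> R) : (0 < k <= #|{: S}|)%N ->
  (forall x, xi x <= b) ->
  kth_eigenvalue k (linfun (anderson e xi)) <= e ^- 2 * (4 * d)%:R + b.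
Proof.
move=> /andP[k0 kS] xib.
apply: (kth_eigenvalue_le (@anderson_sym R d S e xi) (W := fullv)).
- by rewrite k0.
- by rewrite dimvf /dim/= muln1.
move=> g _; rewrite anderson_quad mulrDl lerD//.
  rewrite -mulrA ler_wpM2l ?invr_ge0 ?sqr_ge0// dot_sqnorm energy_le_sqnorm//.
  exact: fin_supp_extend0.
rewrite mulr_sumr; apply: ler_sum => x _.
by rewrite -expr2 ler_wpM2r ?sqr_ge0.
Qed.

End TestFunctions.

(** * Tent functions and lattice points of the domain *)

Section Tent.
Variables (R : realType) (d : nat).
Local Notation Z := 'rV[int]_d.

Definition supnorm (z : Z) : nat := \max_i `|z ord0 i|%N.

Lemma supnorm_le (z : Z) n : (supnorm z <= n)%N <-> forall i, (`|z ord0 i| <= n)%N.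
Proof.
split=> [zn i|zn]; last exact/bigmax_leqP.
by apply: leq_trans zn; exact: (leq_bigmax i).
Qed.

Lemma supnorm_shift (z : Z) i : (supnorm (z + unit_vec i) <= (supnorm z).+1)%N.
Proof.
apply/supnorm_le => j; have /supnorm_le/(_ j) := leqnn (supnorm z).
by rewrite !mxE; case: (_ && _) => /=; lia.
Qed.

Lemma supnorm_shiftN (z : Z) i : (supnorm z <= (supnorm (z + unit_vec i)).+1)%N.
Proof.
apply/supnorm_le => j; have /supnorm_le/(_ j) := leqnn (supnorm (z + unit_vec i)).
by rewrite !mxE; case: (_ && _) => /=; lia.
Qed.

Lemma zsum_le_box (F : Z -> R) (q : Z) (n : nat) : (forall x, F x <= 1) ->
  (forall x, F x != 0 -> (supnorm (x - q) <= n)%N) ->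
  zsum F <= (2 * n).+1%:R ^+ d.
Proof.
move=> F1 Fn.
pose pt (w : {ffun 'I_d -> 'I_(2 * n).+1}) : Z := q + \row_i ((w i)%:Z - n%:Z).
have ptI : injective pt.
  move=> v w /addrI/rowP vw; apply/ffunP => i; apply/val_inj => /=.
  by have := vw i; rewrite !mxE => /addIr -[].
rewrite (zsumE (B := [fset pt w | w in {ffun 'I_d -> 'I_(2 * n).+1}]%fset)); last first.
  move=> x; apply: contraNeq => /Fn/supnorm_le xn; apply/imfsetP.
  exists [ffun i => inord `|((x - q) ord0 i + n%:Z)%R|%N] => //.
  apply/rowP => i; rewrite !mxE ffunE.
  have := xn i; rewrite !mxE [ord0]ord1 => xqn; rewrite inordK; last by lia.
  rewrite gez0_abs ?addrK ?[q _ _ + _]addrC ?subrK//; lia.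
rewrite big_imfset/=; last by move=> v w _ _ /ptI.
apply: le_trans (ler_sum _ (fun w _ => F1 (pt w))) _.
by rewrite big_enum sumr_const card_ffun !card_ord natrX.
Qed.

(** Truncated subtraction of natural numbers makes the function vanish outside
    the cube of radius [n]. *)
Definition tent (q : Z) (n : nat) (x : Z) : R := (n - supnorm (x - q))%:R.

Lemma tent_out q n x : (n <= supnorm (x - q))%N -> tent q n x = 0.
Proof. by rewrite /tent -subn_eq0 => /eqP ->. Qed.

Lemma tent_neq0 q n x : tent q n x != 0 -> (supnorm (x - q) < n)%N.
Proof. by rewrite ltnNge; apply: contra_neqN => /tent_out. Qed.

Lemma fin_supp_tent q n : fin_supp (tent q n).
Proof.
exists (fset_set [set x | forall i, `|(x - q) ord0 i| <= n%:Z]) => x.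
have fin : finite_set [set x : Z | forall i, `|(x - q) ord0 i| <= n%:Z].
  apply: (@sub_finite_set _ _
    ((fun y => y + q) @` [set x : Z | forall i, `|x ord0 i| <= n%:Z])).
    by move=> y yn; exists (y - q) => //; rewrite subrK.
  exact/finite_image/finite_lattice_box.
rewrite in_fset_set// => /negP; rewrite inE => xn; apply: tent_out.
rewrite leqNgt; apply/negP => /ltnW/supnorm_le xn'; apply: xn => i /=.
by have := xn' i; lia.
Qed.

Lemma energy_tent q n : (0 < n)%N -> energy (tent q n) <= d%:R * (3 * n)%:R ^+ d.
Proof.
move=> n0; rewrite -[X in X%:R * _](card_ord d) mulr_natl -sumr_const.
apply: ler_sum => i _; have step x : `|tent q n (x + unit_vec i) - tent q n x| <= 1.
  have h1 := supnorm_shift (x - q) i; have h2 := supnorm_shiftN (x - q) i.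
  have h : (n - supnorm (x - q + unit_vec i) <= (n - supnorm (x - q)).+1)%N by lia.
  have h' : (n - supnorm (x - q) <= (n - supnorm (x - q + unit_vec i)).+1)%N by lia.
  rewrite /tent (addrAC x); move: h h'.
  by rewrite -!(ler_nat R) -!natr1 ler_norml; lra.
apply: le_trans (_ : (2 * n).+1%:R ^+ d <= _); last first.
  by rewrite lerXn2r ?nnegrE// ler_nat; lia.
apply: (@zsum_le_box _ q) => x.
  by rewrite -real_normK ?num_real// expr_le1.
rewrite sqrf_eq0; apply: contraNT; rewrite -ltnNge => xn.
rewrite !tent_out ?subrr//; first exact: ltnW.
have := supnorm_shiftN (x - q) i; rewrite (addrAC x) => h.
by rewrite -ltnS; exact: leq_trans xn h.
Qed.

Lemma sqnorm_tent q n : (0 < n)%N ->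
  n%:R ^+ 2 * n%:R ^+ d <= 4 * sqnorm (tent q n).
Proof.
move=> n0; pose pt (w : {ffun 'I_d -> 'I_n}) : Z := q + \row_i ((w i)%:Z - (n./2)%:Z).
have ptI : injective pt.
  move=> v w /addrI/rowP vw; apply/ffunP => i; apply/val_inj => /=.
  by have := vw i; rewrite !mxE => /addIr -[].
have lo : \sum_w tent q n (pt w) ^+ 2 <= sqnorm (tent q n).
  exact: (@sum_inj_le_zsum R _ _ pt (fun x => tent q n x ^+ 2) ptI
    (fin_supp_sqr (fin_supp_tent q n)) (fun x => sqr_ge0 _)).
apply: (@le_trans _ _ (4 * \sum_w tent q n (pt w) ^+ 2)); last by rewrite ler_pM2l.
rewrite mulr_sumr [n%:R ^+ 2 * _]mulrC -natrX.
have -> : (n ^ d)%N = #|{ffun 'I_d -> 'I_n}| by rewrite card_ffun !card_ord.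
rewrite mulr_natl -sumr_const; apply: ler_sum => w _.
(* on the cube of radius [n./2], which has at least [n ^ d] points, the tent
   is at least [n / 2] *)
have sw : (supnorm (pt w - q) <= n./2)%N.
  apply/supnorm_le => i; rewrite /pt addrAC subrr add0r mxE.
  have nh : (n <= (2 * n./2).+1)%N by lia.
  move: (nat_of_ord (w i)) (ltn_ord (w i)) (n./2) nh => y yn h nh.
  lia.
have -> : 4 * tent q n (pt w) ^+ 2 = (2 * tent q n (pt w)) ^+ 2 by rewrite exprMn; ring.
rewrite lerXn2r ?nnegrE ?mulr_ge0//; rewrite /tent -natrM ler_nat.
have := odd_double_half n; lia.
Qed.

End Tent.

Section Geometry.
Variables (R : realType) (d : nat) (D : set 'rV[R]_d).
Local Notation Z := 'rV[int]_d.

Lemma rV_norm_le (v : 'rV[R]_d) (c : R) : 0 <= c ->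
  (forall i, `|v ord0 i| <= c) -> `|v| <= c.
Proof.
move=> c0 vc; rewrite /Num.norm/= mx_normrE; apply: bigmax_le => // -[i j] _ /=.
by rewrite (ord1 i).
Qed.

Lemma rV_norm_ge (v : 'rV[R]_d) i : `|v ord0 i| <= `|v|.
Proof.
rewrite [leRHS]/Num.norm/= mx_normrE.
exact: (le_bigmax _ (fun ij => `|v ij.1 ij.2|) (ord0, i)).
Qed.

Lemma lattice_domain_sub e x : 0 < e -> bounded_set D ->
  x \in lattice_domain D e -> D (scaled e x).
Proof.
move=> e0 bD xD; have : [set` lattice_domain D e] x by [].
rewrite lattice_domainP//= => xe; apply: contrapT => nDx; move: xe.
rewrite ltNge => /negP; apply.
apply: (@le_trans _ _ `|scaled e x - scaled e x|%:E).
  by apply: ereal_inf_lbound; exists (scaled e x).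
by rewrite subrr normr0 lee_fin ltW.
Qed.

Lemma lattice_domain_ball p r e x : 0 < e -> bounded_set D -> ball p r `<=` D ->
  `|scaled e x - p| + e < r -> x \in lattice_domain D e.
Proof.
move=> e0 bD pD xr.
suff : [set` lattice_domain D e] x by [].
rewrite lattice_domainP//=.
apply: (@lt_le_trans _ _ (r - `|scaled e x - p|)%:E).
  by rewrite lte_fin ltrBrDl.
apply: le_ereal_inf_tmp => _ [z Dz <-]; rewrite lee_fin lerBlDr.
rewrite leNgt; apply/negP => zr; apply: Dz; apply: pD.
rewrite -ball_normE /ball_/= (le_lt_trans _ zr)//.
rewrite (_ : p - z = scaled e x - z - (scaled e x - p)) ?ler_normB//.
by rewrite opprB [RHS]addrC addrA subrK.
Qed.

Lemma card_lattice_domain : bounded_set D -> exists C : R, 0 < C /\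
  forall e, 0 < e < 1 -> (#|` lattice_domain D e|)%:R <= C * e ^- d.
Proof.
move=> bD; have [M0 [_ DM]] := bD.
pose M := `|M0| + 1; have M1 : 1 <= M by rewrite lerDr.
have {}DM x : D x -> `|x| <= M.
  by apply: DM; rewrite (le_lt_trans (ler_norm _))// ltrDl.
exists ((3 * M) ^+ d); split; first by rewrite exprn_gt0//; lra.
move=> e /andP[e0 e1]; pose n := Num.truncn (M / e).
have Me1 : 1 <= M / e by rewrite ler_pdivlMr// mul1r; lra.
have nMe : n%:R <= M / e by rewrite truncn_le//; lra.
pose F (x : Z) : R := (x \in lattice_domain D e)%:R.
have -> : (#|` lattice_domain D e|)%:R = zsum F.
  rewrite (zsumE (B := lattice_domain D e)) => [|x /negPf xS]; last by rewrite /F xS.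
  rewrite cardfE -sum1_card natr_sum big_seq_fsetE /=.
  by apply: eq_bigr => x _; rewrite /F fsvalP.
apply: (@le_trans _ _ ((2 * n).+1%:R ^+ d)).
  apply: (@zsum_le_box _ _ _ 0) => x; first by rewrite /F; case: (_ \in _).
  rewrite /F pnatr_eq0 eqb0 negbK => /(lattice_domain_sub e0 bD) /DM xM.
  apply/supnorm_le => i; rewrite subr0 truncn_ge_nat; last by lra.
  have := le_trans (rV_norm_ge _ i) xM.
  rewrite !mxE normrM (gtr0_norm e0) mulrC -ler_pdivlMr//.
  by rewrite natr_absz intr_norm.
rewrite -exprVn -exprMn lerXn2r ?nnegrE ?mulr_ge0 ?invr_ge0 ?(ltW e0)//.
  by lra.
by rewrite -natr1 natrM -mulrA; lra.
Qed.

Lemma lattice_approximation (p : 'rV[R]_d) (e : R) : 0 < e ->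
  exists q : Z, `|scaled e q - p| <= e.
Proof.
move=> e0; exists (\row_i Num.floor (p ord0 i / e)); apply: rV_norm_le => [|i].
  exact: ltW.
rewrite !mxE; set y := p ord0 i.
have /andP[fl fu] := floor_itv (y / e).
move: fl fu; rewrite ler_pdivlMr// ltr_pdivrMr// intrD mulrDl mul1r.
by move: (Num.floor _)%:~R => z; rewrite ler_norml; lra.
Qed.

Lemma scaled_dist (e : R) (x q : Z) n : 0 < e -> (supnorm (x - q) <= n)%N ->
  `|scaled e x - scaled e q| <= e * n%:R.
Proof.
move=> e0 /supnorm_le xn; apply: rV_norm_le => [|i]; first by rewrite mulr_ge0// ltW.
rewrite !mxE -mulrBr normrM (gtr0_norm e0) ler_pM2l// -intrB -intr_norm.
have := xn i; rewrite !mxE -(ler_nat R) natr_absz.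
by rewrite [ord0]ord1.
Qed.

Lemma intervals_disjoint (z : int) (n u v : nat) :
  (`|(z - 2 * u%:Z)%R|%N < n)%N -> (`|(z - 2 * v%:Z)%R|%N < n)%N ->
  (u + n <= v)%N -> False.
Proof. lia. Qed.

(** For [e] bounded away from 0 the operator is bounded uniformly.  For small [e],
    [k] tents of radius [n] of order [e^-1], lined up along one axis, fit into
    the lattice points of a cube contained in [D]; each has energy [O(n ^- 2)]
    times its squared norm, which balances the factor [e ^- 2]. *)
Lemma eigenvalue_uniform_bound (b : R) (k : nat) : (0 < d)%N -> (0 < k)%N ->
  D !=set0 -> open D -> bounded_set D -> exists K : R,
  forall e (xi : lattice_domain D e -> R), 0 < e < 1 ->
    (k <= #|{: lattice_domain D e}|)%N -> (forall x, xi x <= b) ->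
    kth_eigenvalue k (linfun (anderson e xi)) <= K.
Proof.
move=> d0 k0 [p Dp] oD bD.
have [r r0 pD] : exists2 r : R, 0 < r & ball p r `<=` D.
  by have /nbhs_ballP[r /= r0 pD] := open_nbhs_nbhs (conj oD Dp); exists r.
(* with [n <= e^-1 / c], the scaled centres are within [r / 4] of the first one *)
pose c : R := 8 * k%:R / r; have kR : 1 <= k%:R :> R by rewrite ler1n.
have c0 : 0 < c by rewrite divr_gt0//; lra.
pose M0 : R := 4 * d%:R * 3 ^+ d.
have M00 : 0 <= M0 by rewrite !mulr_ge0.
pose K1 := c ^+ 2 * (4 * d)%:R; pose K2 := (2 * c) ^+ 2 * (k%:R * M0).
have K10 : 0 <= K1 by rewrite mulr_ge0 ?sqr_ge0.
have K20 : 0 <= K2 by rewrite mulr_ge0 ?sqr_ge0// mulr_ge0.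
exists (K1 + K2 + b) => e xi /andP[e0 e1] kS xib.
have [ec|ec] := lerP e^-1 c.
  apply: le_trans (eigenvalue_le_trivial e _ xib) _; first by rewrite k0.
  rewrite lerD2r (@le_trans _ _ K1) ?lerDl// ler_wpM2r//.
  by rewrite -exprVn lerXn2r ?nnegrE ?invr_ge0 ?(ltW e0) ?(ltW c0).
pose y := e^-1 / c; have y1 : 1 < y by rewrite ltr_pdivlMr// mul1r.
pose n := Num.truncn y.
have n0 : (0 < n)%N by rewrite truncn_gt0 ltW.
have ny : n%:R <= y by rewrite truncn_le//; lra.
have yn : y < 2 * n%:R.
  apply: lt_le_trans (truncnS_gt y) _; rewrite -/n -natr1.
  have : 1 <= n%:R :> R by rewrite ler1n.
  lra.
have [q0 q0p] := lattice_approximation p e0.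
pose i0 : 'I_d := Ordinal d0.
(* centres at distance [2 n], so that the open cubes of radius [n] are disjoint *)
pose q (j : 'I_k) : Z := q0 + unit_vec i0 *+ (2 * n * j).
pose F (j : 'I_k) := @tent R d (q j) n.
have qi0 j : q j ord0 i0 = q0 ord0 i0 + (2 * n * j)%:Z.
  by rewrite /q mxE mulmxnE mxE !eqxx/= -[(2 * n * j)%:Z]natz.
have qq0 (j : 'I_k) : (supnorm (q j - q0) <= 2 * n * j)%N.
  apply/supnorm_le => i; rewrite /q addrAC subrr add0r mulmxnE mxE.
  by case: (_ && _); rewrite ?mul0rn// (natz (2 * n * j)).
have F_out j x : x \notin lattice_domain D e -> F j x = 0.
  apply: contraNeq => /tent_neq0/ltnW xq.
  apply: (@lattice_domain_ball p r) => //.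
  have h1 := scaled_dist e0 xq; have h2 := scaled_dist e0 (qq0 j).
  have h3 : `|scaled e x - p| <= `|scaled e x - scaled e (q j)| +
      `|scaled e (q j) - scaled e q0| + `|scaled e q0 - p|.
    have -> : scaled e x - p = (scaled e x - scaled e (q j)) +
      (scaled e (q j) - scaled e q0) + (scaled e q0 - p) by rewrite !subrKA.
    by apply: le_trans (ler_normD _ _) _; rewrite lerD2r ler_normD.
  have nj : n%:R + (2 * n * j)%:R <= 2 * k%:R * y.
    rewrite -natrD (@le_trans _ _ ((2 * k) * n)%:R)//; last first.
      by rewrite !natrM ler_wpM2l.
    rewrite ler_nat (_ : n + 2 * n * j = (2 * j + 1) * n)%N; last first.
      by rewrite mulnDl mul1n addnC mulnAC.
    by rewrite leq_mul2r addn1 ltn_pmul2l// ltn_ord orbT.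
  have ey : e * y = r / (8 * k%:R).
    by rewrite /y /c mulrA divff ?gt_eqF// div1r invf_div.
  have eny : e * (n%:R + (2 * n * j)%:R) <= r / 4.
    apply: (@le_trans _ _ (e * (2 * k%:R * y))); first by rewrite ler_wpM2l// ltW.
    rewrite mulrCA ey le_eqVlt; apply/orP; left; apply/eqP; field.
    by rewrite gt_eqF//; lra.
  have er : e <= r / 8.
    apply: (@le_trans _ _ (e * y)); first by rewrite ler_peMr// ltW.
    rewrite ey ler_wpM2l ?(ltW r0)// lef_pV2 ?posrE//; lra.
  move: h1 h2 h3 eny q0p; rewrite mulrDr; lra.
have F_disj i j x : i != j -> F i x * F j x = 0.
  move=> ij; apply/eqP; rewrite mulf_eq0 -[_ || _]negbK negb_or; apply/negP.
  move=> /andP[/tent_neq0 hi /tent_neq0 hj].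
  have coord (j' : 'I_k) : (supnorm (x - q j') < n)%N ->
      (`|(x ord0 i0 - q0 ord0 i0 - 2 * (n * j')%:Z)%R|%N < n)%N.
    move=> hj'; have := (supnorm_le (x - q j') _).1 (leqnn _) i0.
    rewrite mxE [(- q j') _ _]mxE qi0 opprD addrA => /leq_ltn_trans => /(_ _ hj').
    by rewrite -mulnA PoszM.
  move: (coord _ hi) (coord _ hj).
  have sep (i' j' : 'I_k) : (i' < j')%N -> (n * i' + n <= n * j')%N.
    by move=> ij'; rewrite -mulnSr leq_mul2l ij' orbT.
  have /orP[/sep|/sep] : (i < j)%N || (j < i)%N by rewrite -neq_ltn.
    by move=> ij' zi zj; exact: (intervals_disjoint zi zj ij').
  by move=> ji' zi zj; exact: (intervals_disjoint zj zi ji').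
have nR : 0 < n%:R :> R by rewrite ltr0n.
have F_sq j : 0 < sqnorm (F j).
  have : 0 < 4 * sqnorm (F j).
    apply: lt_le_trans (sqnorm_tent R (q j) n0).
    by rewrite mulr_gt0 ?exprn_gt0.
  by rewrite pmulr_rgt0.
have F_energy j : energy (F j) <= (M0 / n%:R ^+ 2) * sqnorm (F j).
  apply: le_trans (energy_tent R (q j) n0) _.
  have := sqnorm_tent R (q j) n0; rewrite -/(F j) natrM exprMn => H4.
  rewrite mulrAC ler_pdivlMr ?exprn_gt0//.
  rewrite (_ : M0 * sqnorm (F j) = d%:R * 3 ^+ d * (4 * sqnorm (F j))); last first.
    by rewrite /M0; ring.
  rewrite [leLHS](_ : _ = d%:R * 3 ^+ d * (n%:R ^+ 2 * n%:R ^+ d)); last by ring.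
  by rewrite ler_wpM2l// mulr_ge0.
apply: le_trans (eigenvalue_le_test e k0 xib F_out F_disj F_sq F_energy) _.
rewrite lerD2r (@le_trans _ _ K2) ?lerDr//.
rewrite [leLHS](_ : _ = e ^- 2 / n%:R ^+ 2 * (k%:R * M0)); last by ring.
rewrite /K2 ler_wpM2r ?mulr_ge0// ler_pdivrMr ?exprn_gt0// -exprVn -exprMn.
have c2 : 0 < 2 * c by rewrite mulr_gt0.
rewrite lerXn2r ?nnegrE ?invr_ge0 ?(ltW e0)//; first by rewrite ltW// mulr_gt0.
by move: yn; rewrite /y ltr_pdivrMr// mulrAC => /ltW.
Qed.
End Geometry.

(** * McDiarmid's inequality on finite products *)

(** Squaring [exp (- x / 2) >= 1 - x / 2] bounds [exp (- x)] from below, and the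
    product of this bound with the right-hand side is at least 1. *)
Lemma expR_le_quadratic (R : realType) (x : R) : x <= 1 -> expR x <= 1 + x + 2 * x ^+ 2.
Proof.
move=> x1; have h : 0 <= 1 - x / 2 by lra.
have -> : x = - (- x / 2) - (- x / 2) by field.
rewrite expRD !expRN -invfM -expRD.
have E : (1 - x / 2) ^+ 2 <= expR (- x / 2 + - x / 2).
  rewrite expRD -expr2 lerXn2r ?nnegrE ?expR_ge0//.
  by apply: le_trans (expR_ge1Dx _); lra.
rewrite -div1r ler_pdivrMr ?expR_gt0//.
have -> : 1 + (- (- x / 2) - - x / 2) + 2 * (- (- x / 2) - - x / 2) ^+ 2 =
  1 + x + 2 * x ^+ 2 by field.
have q0 : 0 <= 1 + x + 2 * x ^+ 2 by nra.
apply: le_trans (ler_wpM2l q0 E).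
have -> : (1 + x + 2 * x ^+ 2) * (1 - x / 2) ^+ 2 =
  1 + x ^+ 2 * ((1 - x) * (5 / 4 - x / 2)) by field.
by rewrite lerDl mulr_ge0 ?sqr_ge0// mulr_ge0; lra.
Qed.

(** The linear term on the right disappears in expectation for a centred
    variable, which leaves a subgaussian bound. *)
Lemma expR_le_subgaussian (R : realType) (x : R) : expR x <= x + expR (2 * x ^+ 2).
Proof.
have [x1|x1] := leP x 1.
  apply: le_trans (expR_le_quadratic x1) _.
  rewrite [1 + x]addrC -addrA lerD2l; exact: expR_ge1Dx.
apply: (@le_trans _ _ (expR (2 * x ^+ 2))); last by rewrite lerDr; lra.
by rewrite ler_expR; nra.
Qed.

Lemma hoeffding_step (R : realType) (G : finType) (q X : G -> R) (c s : R) :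
  (forall u, 0 <= q u) -> \sum_u q u = 1 ->
  (forall u u', `|X u - X u'| <= c) ->
  \sum_u q u * expR (s * X u) <=
    expR (2 * s ^+ 2 * c ^+ 2) * expR (s * \sum_u q u * X u).
Proof.
move=> q0 q1 Xc; set m := \sum_u q u * X u.
have Xm u : `|X u - m| <= c.
  have -> : X u - m = \sum_u' q u' * (X u - X u').
    under eq_bigr do rewrite mulrBr.
    by rewrite sumrB -mulr_suml q1 mul1r.
  apply: (le_trans (ler_norm_sum _ _ _)).
  rewrite -[leRHS]mul1r -q1 mulr_suml; apply: ler_sum => u' _.
  by rewrite normrM (ger0_norm (q0 u')) ler_wpM2l.
rewrite -ler_pdivrMr ?expR_gt0// -expRN mulr_suml.
apply: (@le_trans _ _ (\sum_u q u * (s * (X u - m) + expR (2 * s ^+ 2 * c ^+ 2)))).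
  apply: ler_sum => u _; rewrite -[leLHS]mulrA -expRD ler_wpM2l//.
  rewrite -mulrBr; apply: le_trans (expR_le_subgaussian _) _.
  rewrite lerD2l ler_expR exprMn mulrA; apply: ler_wpM2l.
    by apply: mulr_ge0 => //; exact: sqr_ge0.
  rewrite -[(X u - m) ^+ 2]real_normK ?num_real// lerXn2r ?nnegrE//.
  exact: le_trans (normr_ge0 _) (Xm u).
under eq_bigr do rewrite mulrDr.
rewrite big_split/= -mulr_suml q1 mul1r gerDr.
have -> : \sum_u q u * (s * (X u - m)) = s * (\sum_u q u * X u - (\sum_u q u) * m).
  rewrite mulr_suml -sumrB mulr_sumr; apply: eq_bigr => u _; ring.
by rewrite q1 mul1r subrr mulr0.
Qed.

Section BoundedDifferences.
Variables (R : realType) (I G : finType) (p : I -> G -> R).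
Hypotheses (p0 : forall i u, 0 <= p i u) (p1 : forall i, \sum_u p i u = 1).
Local Notation W := {ffun I -> G}.
Implicit Types (v : W) (g : W -> R).

Definition update v i u : W := [ffun j => if j == i then u else v j].

Definition weight v : R := \prod_i p i (v i).

Definition expect g : R := \sum_v weight v * g v.

(** Conditional expectation given all coordinates but the [i]-th. *)
Definition average i g v : R := \sum_u p i u * g (update v i u).

Lemma weight_ge0 v : 0 <= weight v.
Proof. by apply: prodr_ge0. Qed.

Lemma sum_weight : \sum_v weight v = 1.
Proof.
rewrite /weight -bigA_distr_bigA big1// => i _; exact: p1.
Qed.

Lemma ler_expect g h : (forall v, g v <= h v) -> expect g <= expect h.
Proof. by move=> gh; apply: ler_sum => v _; rewrite ler_wpM2l ?weight_ge0. Qed.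

Lemma expect_scale a g : expect (fun v => a * g v) = a * expect g.
Proof. by rewrite mulr_sumr; apply: eq_bigr => v _; rewrite mulrCA. Qed.

Lemma update_update v i u u' : update (update v i u) i u' = update v i u'.
Proof. by apply/ffunP => j; rewrite !ffunE; case: eqP. Qed.

Lemma update_id v i : update v i (v i) = v.
Proof. by apply/ffunP => j; rewrite !ffunE; case: eqP => [->|]. Qed.

Lemma updateC v i j u w : i != j ->
  update (update v i u) j w = update (update v j w) i u.
Proof.
move=> ij; apply/ffunP => l; rewrite !ffunE; case: eqP => // ->.
by rewrite eq_sym (negPf ij).
Qed.

Lemma weight_update v i u : weight v * p i u = weight (update v i u) * p i (v i).
Proof.
rewrite /weight (bigD1 i)//= [in RHS](bigD1 i)//= ffunE eqxx.
rewrite mulrC [RHS]mulrC !mulrA [p i (v i) * _]mulrC; congr (_ * _).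
by apply: eq_bigr => j ji; rewrite ffunE (negPf ji).
Qed.

(** Exchanging the [i]-th coordinate with an independent copy is an involution
    that preserves the product weight. *)
Lemma expect_average i g : expect (average i g) = expect g.
Proof.
pose h (vu : W * G) := (update vu.1 i vu.2, vu.1 i).
have hK : involutive h.
  move=> [v u]; rewrite /h/= update_update update_id ffunE eqxx//.
transitivity (\sum_(vu : W * G) weight vu.1 * p i vu.2 * g (update vu.1 i vu.2)).
  rewrite -(pair_bigA _ (fun v u => weight v * p i u * g (update v i u)))/=.
  by apply: eq_bigr => v _; rewrite mulr_sumr; apply: eq_bigr => u _; rewrite mulrA.
transitivity (\sum_(vu : W * G) weight vu.1 * p i vu.2 * g vu.1).
  rewrite [RHS](reindex_inj (inv_inj hK))/=.
  by apply: eq_bigr => -[v u] _ /=; rewrite weight_update.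
rewrite -(pair_bigA _ (fun v u => weight v * p i u * g v))/=.
apply: eq_bigr => v _; rewrite -[RHS]mul1r -(p1 i) mulr_suml.
by apply: eq_bigr => u _; ring.
Qed.

Definition bounded_differences c g :=
  forall v i u, `|g (update v i u) - g v| <= c.

Lemma average_bounded_differences c i g :
  bounded_differences c g -> bounded_differences c (average i g).
Proof.
move=> gc v j u; have c0 : 0 <= c.
  by apply: le_trans (gc v i (v i)); rewrite normr_ge0.
rewrite /average -sumrB.
apply: (le_trans (ler_norm_sum _ _ _)).
rewrite -[leRHS]mul1r -(p1 i) mulr_suml; apply: ler_sum => w _.
rewrite -mulrBr normrM (ger0_norm (p0 i w)) ler_wpM2l//.
have [->|ji] := eqVneq j i; first by rewrite update_update subrr normr0.
by rewrite updateC.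
Qed.

Lemma expect_expR_average c s i g : bounded_differences c g ->
  expect (fun v => expR (s * g v)) <=
  expR (2 * s ^+ 2 * c ^+ 2) * expect (fun v => expR (s * average i g v)).
Proof.
move=> gc; rewrite -(expect_average i) -expect_scale; apply: ler_expect => v.
apply: (hoeffding_step (X := fun u => g (update v i u))) => // u u'.
by rewrite -(update_update v i u' u).
Qed.

(** Averaging the coordinates one after the other plays the role of the Doob
    martingale; each step costs one factor of the Hoeffding bound. *)
Lemma expect_expR_averages c s (r : seq I) g : bounded_differences c g ->
  expect (fun v => expR (s * g v)) <=
  expR (2 * s ^+ 2 * c ^+ 2 * (size r)%:R) *
    expect (fun v => expR (s * foldl (fun h i => average i h) g r v)).
Proof.
elim: r g => [|i r IH] g gc /=; first by rewrite mulr0 expR0 mul1r.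
apply: (le_trans (expect_expR_average s i gc)).
rewrite -[X in _ <= expR (_ * X) * _]natr1 mulrDr mulr1 expRD
   [X in _ <= X * _]mulrC -[leRHS]mulrA ler_wpM2l ?expR_ge0//.
exact/IH/average_bounded_differences.
Qed.

Lemma average_indep i g v u : average i g (update v i u) = average i g v.
Proof. by apply: eq_bigr => w _; rewrite update_update. Qed.

(** The second alternative is the induction invariant: independence of a
    coordinate, once reached, survives averaging over the others. *)
Lemma averages_indep (r : seq I) g (i : I) :
  (i \in r) || `[< forall v u, g (update v i u) = g v >] ->
  forall v u, foldl (fun h i => average i h) g r (update v i u) =
              foldl (fun h i => average i h) g r v.
Proof.
elim: r g => [|j r IH] g /= H v u; first by move/asboolP: H => ->.
apply: IH; move: H; rewrite in_cons => /orP[/orP[/eqP <-|->//]|/asboolP gi].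
  by apply/orP; right; apply/asboolP => v' u'; exact: average_indep.
apply/orP; right; apply/asboolP => v' u'.
have [->|ij] := eqVneq i j; first exact: average_indep.
by apply: eq_bigr => w _; rewrite updateC// gi.
Qed.

Lemma indep_const (h : W -> R) : (forall v i u, h (update v i u) = h v) ->
  forall v v', h v = h v'.
Proof.
move=> hi v v'.
have -> : v' = foldr (fun i w => update w i (v' i)) v (enum I).
  apply/ffunP => i; have : i \in enum I by rewrite mem_enum.
  elim: (enum I) => [//|j r IH]; rewrite in_cons /= ffunE.
  by case: eqP => [->|].
by elim: (enum I) => [//|j r IH] /=; rewrite hi.
Qed.

(** After averaging over every coordinate the function is constant, hence equal
    to its expectation. *)
Lemma mgf_bound c s g : bounded_differences c g ->
  expect (fun v => expR (s * g v)) <=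
  expR (2 * s ^+ 2 * c ^+ 2 * #|I|%:R) * expR (s * expect g).
Proof.
move=> gc; apply: le_trans (expect_expR_averages s (enum I) gc) _.
rewrite -cardE ler_wpM2l ?expR_ge0//.
set h := foldl _ _ _.
have hc : forall v v', h v = h v'.
  apply: indep_const => v i u; apply: averages_indep; first by rewrite mem_enum.
have Eh : expect h = expect g.
  rewrite /h; elim: (enum I) (g) => [//|i r IH] g' /=.
  by rewrite IH expect_average.
have hE v : h v = expect g.
  rewrite -Eh /expect (eq_bigr (fun v' => weight v' * h v)) => [|v' _].
    by rewrite -mulr_suml sum_weight mul1r.
  by rewrite (hc v' v).
rewrite /expect (eq_bigr (fun v => weight v * expR (s * expect g))) => [|v _].
  by rewrite -mulr_suml sum_weight mul1r.
by rewrite hE.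
Qed.

Lemma upper_tail c B t g : bounded_differences c g ->
  c ^+ 2 * #|I|%:R <= B -> 0 < B -> 0 < t ->
  \sum_(v | t <= g v - expect g) weight v <= expR (- (t ^+ 2 / (8 * B))).
Proof.
move=> gc cB B0 t0.
(* minimizes [2 s ^ 2 B - s t] *)
pose s := t / (4 * B).
have s0 : 0 < s by rewrite divr_gt0// mulr_gt0.
pose a := expR (s * (expect g + t)).
have a0 : 0 < a by exact: expR_gt0.
rewrite -(ler_pM2l a0).
apply: (@le_trans _ _ (expect (fun v => expR (s * g v)))).
  rewrite mulr_sumr /expect big_mkcond/=; apply: ler_sum => v _.
  case: ifPn => [tv|_]; last by rewrite mulr_ge0 ?weight_ge0 ?expR_ge0.
  rewrite mulrC ler_wpM2l ?weight_ge0// /a ler_expR ler_wpM2l ?(ltW s0)//.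
  by rewrite addrC -lerBrDr.
apply: le_trans (mgf_bound s gc) _.
rewrite /a -!expRD ler_expR mulrDr addrC -addrA lerD2l.
have h : 2 * s ^+ 2 * c ^+ 2 * #|I|%:R <= 2 * s ^+ 2 * B.
  by rewrite -mulrA ler_wpM2l// mulr_ge0// sqr_ge0.
apply: (le_trans h); rewrite le_eqVlt; apply/orP; left; apply/eqP.
by rewrite /s; field; rewrite gt_eqF.
Qed.

Lemma expectN g : expect (fun v => - g v) = - expect g.
Proof. by rewrite /expect -sumrN; apply: eq_bigr => v _; rewrite mulrN. Qed.

Lemma mcdiarmid c B t g : bounded_differences c g ->
  c ^+ 2 * #|I|%:R <= B -> 0 < B -> 0 < t ->
  \sum_(v | t <= `|g v - expect g|) weight v <= 2 * expR (- (t ^+ 2 / (8 * B))).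
Proof.
move=> gc cB B0 t0.
have gcN : bounded_differences c (fun v => - g v).
  by move=> v i u; rewrite -opprD normrN.
apply: (@le_trans _ _ (\sum_(v | t <= g v - expect g) weight v +
    \sum_(v | t <= - g v - expect (fun v => - g v)) weight v)).
  rewrite big_mkcond [X in _ <= X + _]big_mkcond [X in _ <= _ + X]big_mkcond.
  rewrite -big_split/=; apply: ler_sum => v _.
  rewrite expectN -opprD ler_normr; have := weight_ge0 v.
  by case: (t <= g v - _); case: (t <= - _) => /=; lra.
by rewrite mulr_natl mulr2n lerD// (upper_tail (c := c)).
Qed.

End BoundedDifferences.

(** * Concentration for Lipschitz functions of independent variables *)

Section FiniteRange.
Context (d : measure_display) (T : measurableType d) (R : realType).
Variable (P : probability T R).

(** [Lam Y < s] holds exactly when [Y] is within some rational [dl] of a rational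
    point [q] with [Lam q + dl < s]; this is a countable union of measurable
    sets. *)
Lemma measurable_lipschitz (I : finType) (Lam : (I -> R) -> R) (Y : I -> T -> R) :
  (forall (x y : I -> R) eta, (forall i, `|x i - y i| <= eta) ->
    `|Lam x - Lam y| <= eta) ->
  (forall i, measurable_fun setT (Y i)) ->
  measurable_fun setT (fun w => Lam (Y^~ w)).
Proof.
move=> lip mY mT.
apply: (measurability _ (measurable_realfun.RGenInftyO.measurableE R)) => //.
move=> _ [_ [s ->] <-]; rewrite setTI.
pose C (q : {ffun I -> rat} * rat) : set T :=
  if Lam (fun i => ratr (q.1 i)) + ratr q.2 < s then
    [set w | forall i, `|Y i w - ratr (q.1 i)| < ratr q.2] else set0.
rewrite (_ : _ @^-1` _ = \bigcup_q C q).
  apply: countable_bigcupT_measurable => [|q]; first exact: countableP.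
  rewrite /C; case: ifP => // _.
  rewrite (_ : [set w | _] = \bigcap_(i in [set: I])
      Y i @^-1` `](ratr (q.1 i) - ratr q.2), (ratr (q.1 i) + ratr q.2)[).
    apply: fin_bigcap_measurable => // i _.
    by rewrite -[X in measurable X]setTI; apply: mY => //; exact: measurable_itv.
  apply/seteqP; split=> w /= H i => [_|]; have := H i.
    by rewrite /= in_itv/= ltr_distl.
  by move=> /(_ Logic.I); rewrite /= in_itv/= ltr_distl.
apply/seteqP; split=> w /=; rewrite in_itv/=.
  move=> Ls; set g := s - Lam (Y^~ w); have g0 : 0 < g by rewrite subr_gt0.
  have [dl] := @rat_in_itvoo R 0 (g / 2) (divr_gt0 g0 (ltr0n _ 2)).
  rewrite in_itv/= => /andP[dl0 dlg].
  have /choice[q qP] : forall i, exists q : rat, `|Y i w - ratr q| < ratr dl.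
    move=> i; have Yi : Y i w - ratr dl < Y i w + ratr dl by rewrite ltrD2l gtrN.
    have [q] := rat_in_itvoo Yi.
    by rewrite in_itv/= -ltr_distl => qY; exists q; rewrite distrC.
  exists ([ffun i => q i], dl) => //; rewrite /C/=.
  have h : `|Lam (Y^~ w) - Lam (fun i => ratr ([ffun i => q i] i))| <= ratr dl.
    by apply: lip => i; rewrite ffunE ltW.
  rewrite ifT; last by move: h; rewrite ler_norml /g in dlg *; lra.
  by move=> i /=; rewrite ffunE.
move=> [[q dl] _]; rewrite /C/=; case: ifP => // Ls H.
have h : `|Lam (Y^~ w) - Lam (fun i => ratr (q i))| <= ratr dl.
  by apply: lip => i; rewrite ltW.
by move: h; rewrite ler_norml; lra.
Qed.

Lemma integral_finite_fibers (G : finType) (g : T -> G) (h : G -> R) :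
  (forall u, measurable [set w | g w = u]) ->
  (\int[P]_w (h (g w))%:E = (\sum_u fine (P [set w | g w = u]) * h u)%:E)%E.
Proof.
move=> mg.
have -> : (fun w => (h (g w))%:E) =
    (fun w => \sum_u ((h u)%:E * (\1_[set w | g w = u] w)%:E))%E.
  apply/funext => w; rewrite (bigD1 (g w))//= indicE mem_set// mule1.
  rewrite big1 ?adde0// => u ug; rewrite indicE memNset ?mule0//=.
  by move=> gu; rewrite gu eqxx in ug.
have ii u : P.-integrable setT (fun w => ((\1_[set w | g w = u] w)%:E : \bar R)%E).
  by apply: integrable_indic => //; rewrite (le_lt_trans (probability_le1 _ _))// ltry.
rewrite integral_sum//; last by move=> u; apply: integrableZl => //; exact: ii.
rewrite -sumEFin; apply: eq_bigr => u _.
rewrite integralZl// integral_indic// setIT EFinM muleC fineK//.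
exact: fin_num_measure.
Qed.

Lemma probability_finite_fibers (G : finType) (g : T -> G) (Q : pred G) :
  (forall u, measurable [set w | g w = u]) ->
  P [set w | Q (g w)] = (\sum_(u | Q u) fine (P [set w | g w = u]))%:E.
Proof.
move=> mg.
have mQ : measurable [set w | Q (g w)].
  rewrite (_ : [set w | _] = \bigcup_(u in [set u | Q u]) [set w | g w = u]).
    exact: fin_bigcup_measurable.
  apply/seteqP; split=> [w Qw|w [u /= Qu ->//]].
  by exists (g w).
transitivity (\int[P]_w (\1_[set w | Q (g w)] w)%:E)%E.
  by rewrite integral_indic// setIT.
rewrite (_ : (fun w => (\1_[set w | Q (g w)] w)%:E) =
    (fun w => ((Q (g w))%:R)%:E)); last first.
  apply/funext => w; rewrite indicE (_ : (w \in _) = Q (g w))//.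
  by apply/idP/idP; rewrite inE.
rewrite (integral_finite_fibers (fun u => (Q u)%:R) mg) big_mkcond/=; congr EFin.
by rewrite [RHS]big_mkcond/=; apply: eq_bigr => u _; case: (Q u); rewrite ?mulr1 ?mulr0.
Qed.

End FiniteRange.

Section Grid.
Context {R : realType}.
Variables (a b : R) (N : nat).
Hypotheses (ab : a < b) (N0 : (0 < N)%N).

Definition mesh : R := (b - a) / N%:R.
Definition clamp (x : R) : R := Num.max a (Num.min b x).
(** Values above [b] fall into the last cell by [minn], values below [a] into the
    first one because [Num.truncn] is 0 on negative numbers. *)
Definition cell (x : R) : 'I_N.+1 := inord (minn N (Num.truncn ((x - a) / mesh))).
Definition node (u : 'I_N.+1) : R := a + mesh * u%:R.

Lemma mesh_gt0 : 0 < mesh.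
Proof. by rewrite divr_gt0 ?subr_gt0// ltr0n. Qed.

Lemma mesh_mul : mesh * N%:R = b - a.
Proof. by rewrite /mesh divfK// pnatr_eq0 -lt0n. Qed.

Lemma clamp_itv x : a <= clamp x <= b.
Proof.
rewrite /clamp le_max lexx/= ge_max (ltW ab)/=.
by rewrite ge_min lexx.
Qed.

Lemma clamp_id x : a <= x <= b -> clamp x = x.
Proof. by move=> /andP[ax xb]; rewrite /clamp min_r// max_r. Qed.

Lemma node_itv u : a <= node u <= b.
Proof.
rewrite /node lerDl mulr_ge0 ?(ltW mesh_gt0)//= -lerBrDl -mesh_mul.
by rewrite ler_wpM2l ?(ltW mesh_gt0)// ler_nat -ltnS.
Qed.

(** Comparing with [clamp x] instead of [x] makes the approximation valid
    everywhere, not only where the bounds on the potential hold. *)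
Lemma node_cell x : `|clamp x - node (cell x)| <= mesh.
Proof.
have h0 := mesh_gt0; have hN := mesh_mul.
rewrite /node /cell inordK ?ltnS ?geq_minl//.
set y := (x - a) / mesh; have xy : x = a + mesh * y.
  by rewrite /y mulrC divfK ?gt_eqF// addrC subrK.
clearbody y; have [y0|y0] := ltP y 0.
  have my : mesh * y < 0 by rewrite pmulr_rlt0.
  have -> : Num.truncn y = 0%N by rewrite truncn_floor leNgt y0.
  rewrite minn0 mulr0 addr0 /clamp min_r ?max_l ?subrr ?normr0 ?(ltW h0)//.
    lra.
  by apply: (le_trans _ (ltW ab)); lra.
have my : 0 <= mesh * y by rewrite mulr_ge0// ltW.
have ty : (Num.truncn y)%:R <= y by rewrite truncn_le.
have yt := truncnS_gt y.
have [yN|Ny] := ltP y N%:R.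
  have tN : (Num.truncn y <= N)%N by rewrite -(ler_nat R) (le_trans ty)// ltW.
  rewrite (minn_idPr tN) clamp_id; last first.
    have : mesh * y <= mesh * N%:R by rewrite ler_wpM2l// ltW.
    lra.
  rewrite xy opprD addrACA subrr add0r -mulrBr normrM (gtr0_norm h0).
  rewrite ler_piMr ?(ltW h0)// ger0_norm; first by move: yt; rewrite -natr1; lra.
  lra.
have Nt : (N <= Num.truncn y)%N by rewrite truncn_ge_nat.
rewrite (minn_idPl Nt) hN /clamp min_l; last first.
  have : mesh * N%:R <= mesh * y by rewrite ler_wpM2l// ltW.
  lra.
rewrite max_r ?(ltW ab)// (_ : b - _ = 0) ?normr0 ?(ltW h0)//; lra.
Qed.

Lemma measurable_cell u : measurable [set x | cell x = u].
Proof.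
have h0 := mesh_gt0.
rewrite (_ : [set x | _] =
  (if u == N :> nat then setT else `]-oo, (a + mesh * u.+1%:R)[%classic) `&`
  (if u == 0%N :> nat then setT else `[(a + mesh * u%:R), +oo[%classic)).
  by apply: measurableI; case: ifP => _; [exact: measurableT|exact: measurable_itv|
    exact: measurableT|exact: measurable_itv].
have t_le x k : (Num.truncn ((x - a) / mesh) <= k)%N = (x < a + mesh * k.+1%:R).
  by rewrite truncn_le_nat ltr_pdivrMr// ltrBlDl mulrC.
have t_ge x k : (0 < k)%N ->
    (k <= Num.truncn ((x - a) / mesh))%N = (a + mesh * k%:R <= x).
  by case: k => // k _; rewrite truncn_gt_nat ler_pdivlMr// lerBrDl mulrC.
have cellE x : cell x = u <->
    ((u == N :> nat) || (Num.truncn ((x - a) / mesh) <= u)%N) &&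
    (u <= Num.truncn ((x - a) / mesh))%N.
  rewrite /cell; move: (Num.truncn _) (ltn_ord u) => t; rewrite ltnS => uN.
  split=> [<-|H].
    by rewrite inordK ?ltnS ?geq_minl// geq_minr andbT; lia.
  by apply/val_inj; rewrite /= inordK ?ltnS ?geq_minl//; lia.
apply/seteqP; split=> x /=.
  move=> /cellE /andP[h1 h2]; split.
    by case: eqP h1 => //= _; rewrite in_itv/= t_le.
  by case: eqP => //= /eqP; rewrite -lt0n => u0; rewrite in_itv/= andbT -t_ge.
move=> [h1 h2]; apply/cellE/andP; split.
  by move: h1; case: eqP => //= _; rewrite in_itv/= t_le.
move: h2; case: (posnP u) => [->//|u0].
by rewrite /= in_itv/= andbT -t_ge.
Qed.

Lemma measurable_clamp : measurable_fun setT clamp.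
Proof.
apply: measurable_maxr; first exact: measurable_cst.
by apply: measurable_minr; [exact: measurable_cst|exact: measurable_id].
Qed.

End Grid.

Lemma close_deviation (R : realType) (x y z m e t : R) :
  t < `|x - z| -> `|x - y| <= e -> `|z - m| <= e -> e <= t / 4 ->
  t / 2 <= `|y - m|.
Proof.
move=> tx xy zm et; have : `|x - z| <= `|x - y| + `|y - m| + `|z - m|.
  rewrite (_ : x - z = (x - y) + (y - m) + (m - z)); last by ring.
  by rewrite (distrC z m) (le_trans (ler_normD _ _))// lerD2r ler_normD.
lra.
Qed.

Section Concentration.
Context (dT : measure_display) (T : measurableType dT) (R : realType).
Variables (P : probability T R) (I : finType) (X : I -> {RV P >-> R}).
Variables (a b : R) (Lam : (I -> R) -> R) (c B t : R).
Hypothesis ab : a < b.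
Hypothesis indX : mutually_independent X.
Hypothesis Xab : forall i, {ae P, forall w, a <= X i w <= b}.
Hypothesis lip : forall (x y : I -> R) eta,
  (forall i, `|x i - y i| <= eta) -> `|Lam x - Lam y| <= eta.
Hypothesis bd : forall (x y : I -> R) i0,
  (forall i, a <= x i <= b) -> (forall i, a <= y i <= b) ->
  (forall i, i != i0 -> x i = y i) -> `|Lam x - Lam y| <= c.
Hypotheses (cB : c ^+ 2 * #|I|%:R <= B) (B0 : 0 < B) (t0 : 0 < t).

(* fine enough for the mesh to be at most [t / 4] *)
Let N := (Num.truncn (4 * (b - a) / t)).+1.
Let N0 : (0 < N)%N. Proof. by []. Qed.
Let h := mesh a b N.
Let h_le : h <= t / 4.
Proof.
have : 4 * (b - a) / t < N%:R by exact: truncnS_gt.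
rewrite /h /mesh ltr_pdivrMr// ler_pdivrMr ?ltr0n//.
by move: (N%:R) => z; lra.
Qed.

Let p i u : R := fine (P [set w | cell a b N (X i w) = u]).
Let Y (w : T) : {ffun I -> 'I_N.+1} := [ffun i => cell a b N (X i w)].
Let g (v : {ffun I -> 'I_N.+1}) : R := Lam (fun i => node a b (v i)).
Let L w := Lam (fun i => X i w).
Let L' w := Lam (fun i => clamp a b (X i w)).

Let mcell i u : measurable [set w | cell a b N (X i w) = u].
Proof.
rewrite -[X in measurable X]setTI.
exact: (measurable_funPT (X i)) measurableT _ (measurable_cell ab N0 u).
Qed.

Let fiberE v : [set w | Y w = v] =
  \bigcap_(i in [set` [set: I]%SET]) X i @^-1` [set x | cell a b N x = v i].
Proof.
apply/seteqP; split=> w /=.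
  by move=> <- i _ /=; rewrite ffunE.
by move=> H; apply/ffunP => i; rewrite ffunE; apply: H; rewrite /= inE.
Qed.

Let mfiber v : measurable [set w | Y w = v].
Proof. by rewrite fiberE; apply: fin_bigcap_measurable => // i _; exact: mcell. Qed.

Let p_ge0 i u : 0 <= p i u. Proof. exact: fine_ge0. Qed.

Let p_sum1 i : \sum_u p i u = 1.
Proof.
have := probability_finite_fibers P (g := fun w => cell a b N (X i w)) xpredT (mcell i).
rewrite (_ : [set w | _] = setT); last by apply/seteqP.
by rewrite probability_setT => -[].
Qed.

(** Independence enters here: the rounded variables have a product law. *)
Let weightE v : fine (P [set w | Y w = v]) = weight p v.
Proof.
rewrite fiberE indX; last first.
  by move=> i; exact: measurable_cell.
rewrite (eq_bigl xpredT) => [|i]; last by rewrite inE.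
rewrite (eq_bigr (fun i => (p i (v i))%:E)) => [|i _].
  by rewrite prodEFin.
by rewrite /p fineK// fin_num_measure.
Qed.

Let expectationE : (\int[P]_w (g (Y w))%:E = (expect p g)%:E)%E.
Proof.
rewrite integral_finite_fibers//; congr EFin; apply: eq_bigr => v _.
by rewrite weightE.
Qed.

Let L'_close w : `|L' w - g (Y w)| <= h.
Proof. by apply: lip => i; rewrite ffunE; exact: node_cell. Qed.

Let mL : measurable_fun setT L.
Proof. exact: (measurable_lipschitz lip). Qed.

Let mL' : measurable_fun setT L'.
Proof.
apply: (measurable_lipschitz (Y := fun i w => clamp a b (X i w)) lip) => i.
by apply: measurableT_comp => //; exact: measurable_clamp.
Qed.

Let mgY : measurable_fun setT (fun w => g (Y w)).
Proof.
move=> _ A mA; rewrite setTI.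
rewrite (_ : _ @^-1` _ = \bigcup_(v in [set v | A (g v)]) [set w | Y w = v]).
  exact: fin_bigcup_measurable.
by apply/seteqP; split=> [w Aw|w [v /= Av Yw]]; [exists (Y w)|rewrite /= Yw].
Qed.

Let all_ab : {ae P, forall w, forall i, a <= X i w <= b}.
Proof.
have : {ae P, forall w, forall i, i \in enum I -> a <= X i w <= b}.
  elim: (enum I) => [|i r IH]; first by apply: aeW => w i.
  apply: filterS2 (Xab i) IH => w Hi Hr j.
  by rewrite in_cons => /orP[/eqP ->//|/Hr].
by apply: filterS => w H i; apply: H; rewrite mem_enum.
Qed.

Let LL' : {ae P, forall w, L w = L' w}.
Proof.
apply: filterS all_ab => w H; congr Lam; apply/funext => i.
by rewrite clamp_id.
Qed.

Let iL' : P.-integrable setT (EFin \o L').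
Proof.
apply: measurable_bounded_integrable => //.
  by rewrite -ge0_fin_numE ?fin_num_measure.
exists (`|Lam (fun=> a)| + (b - a)); split; first exact: num_real.
move=> M MM w _; apply: (le_trans _ (ltW MM)).
rewrite -lerBlDl; apply: (le_trans (lerB_dist _ _)); apply: lip => i.
have /andP[h1 h2] := clamp_itv ab (X i w).
by rewrite ger0_norm ?subr_ge0// lerD2r.
Qed.

Let igY : P.-integrable setT (EFin \o (fun w => g (Y w))).
Proof.
apply: measurable_bounded_integrable => //.
  by rewrite -ge0_fin_numE ?fin_num_measure.
exists (\sum_v `|g v|); split; first exact: num_real.
move=> M MM w _; apply: (le_trans _ (ltW MM)).
by rewrite (bigD1 (Y w))//= lerDl sumr_ge0.
Qed.

Let mean_close : `|fine 'E_P[L]%E - expect p g| <= h.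
Proof.
have -> : 'E_P[L]%E = (\int[P]_w (L' w)%:E)%E.
  rewrite unlock; apply: ae_eq_integral => //.
  - exact/measurable_EFinP.
  - exact/measurable_EFinP.
  - by apply: filterS LL' => w -> _.
have fL' : (\int[P]_w (L' w)%:E)%E \is a fin_num by exact: integrable_fin_num.
rewrite -lee_fin -abse_EFin EFinB fineK// -expectationE -integralB_EFin//.
apply: (le_trans (le_abse_integral _ _ _)) => //.
  apply/measurable_EFinP; exact: measurable_funB.
apply: (@le_trans _ _ (h%:E * P setT)%E); last by rewrite probability_setT mule1.
apply: integral_le_bound => //.
- apply/measurable_EFinP; exact: measurable_funB.
- by rewrite lee_fin ltW// mesh_gt0.
- by apply: aeW => w _; rewrite -EFinB abse_EFin lee_fin.
Qed.

(** Almost surely [L] is within [h <= t / 4] of the function [g] of the rounded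
    variables, and so are the two means; a deviation by [t] of [L] forces one
    by [t / 2] of [g], to which the finite inequality applies. *)
Lemma lipschitz_concentration :
  (P [set w | (t < `|L w - fine 'E_P[L]%E|)%R] <=
   (2 * expR (- (t ^+ 2 / (32 * B))))%:E)%E.
Proof.
pose Q (v : {ffun I -> 'I_N.+1}) := t / 2 <= `|g v - expect p g|.
have mQ : measurable [set w | Q (Y w)].
  rewrite (_ : [set w | _] = \bigcup_(v in [set v | Q v]) [set w | Y w = v]).
    exact: fin_bigcup_measurable.
  by apply/seteqP; split=> [w Aw|w [v /= Av Yw]]; [exists (Y w)|rewrite /= Yw].
have mE : measurable [set w | (t < `|L w - fine 'E_P[L]%E|)%R].
  rewrite -[X in measurable X]setTI; apply: measurable_fun_ltr => //.
  apply: measurableT_comp => //; exact: measurable_funB.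
have [M [mM PM0 LM]] := LL'.
apply: (@le_trans _ _ (P [set w | Q (Y w)])).
  have sub : [set w | (t < `|L w - fine 'E_P[L]%E|)%R] `<=` [set w | Q (Y w)] `|` M.
    move=> w /= tL; have [LLw|LLw] := eqVneq (L w) (L' w); last first.
      by right; apply: LM; exact/eqP.
    left; move: tL (L'_close w) mean_close h_le; rewrite LLw /Q.
    move: (L' w) (g (Y w)) (fine _) (expect p g) h => x y z m e tx xy zm et.
    exact: (close_deviation tx xy zm et).
  apply: le_trans (le_measure P _ _ sub) _; rewrite ?inE//.
    exact: measurableU.
  apply: (@le_trans _ _ (P [set w | Q (Y w)] + P M)%E); first exact: measureU2.
  by rewrite PM0 adde0.
rewrite (probability_finite_fibers P Q mfiber) lee_fin.
under eq_bigr do rewrite weightE.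
have gc : bounded_differences c g.
  move=> v i u; apply: (bd (i0 := i)) => [j|j|j ji]; try exact: node_itv.
  by rewrite ffunE (negPf ji).
have t2 : 0 < t / 2 by rewrite divr_gt0.
apply: le_trans (mcdiarmid p_ge0 p_sum1 gc cB B0 t2) _.
rewrite ler_pM2l// ler_expR lerN2 le_eqVlt; apply/orP; left; apply/eqP.
by field; rewrite gt_eqF.
Qed.

End Concentration.

(** * Concentration of the eigenvalues *)

(** The perturbation is supported at one site, where vectors of low energy
    carry little mass. *)
Lemma eigenvalue_bounded_difference (R : realType) (d : nat)
    (S : {fset 'rV[int]_d}) (e a b K C : R) (k : nat) (x y : S -> R) (i0 : S) :
  (0 < k <= #|{: S}|)%N -> 0 < e < 1 -> 0 <= C ->
  (forall (xi : S -> R) s (f : {ffun S -> R^o}) z, (forall z, a <= xi z <= b) ->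
    uniq s -> {in s, forall r, r <= K} ->
    f \in (\sum_(r <- s) passmx.leigenspace (linfun (anderson e xi)) r)%VS ->
    f z ^+ 2 <= C * e ^+ d * dot f f) ->
  (forall xi : S -> R, (forall z, xi z <= b) ->
    kth_eigenvalue k (linfun (anderson e xi)) <= K) ->
  (forall i, a <= x i <= b) -> (forall i, a <= y i <= b) ->
  (forall i, i != i0 -> x i = y i) ->
  `|kth_eigenvalue k (linfun (anderson e x)) -
    kth_eigenvalue k (linfun (anderson e y))| <= (b - a) * C * e ^+ d.
Proof.
move=> kS e01 C0 sup lamK.
suff le1 (x' y' : S -> R) : (forall i, a <= x' i <= b) ->
    (forall i, a <= y' i <= b) -> (forall i, i != i0 -> x' i = y' i) ->
    kth_eigenvalue k (linfun (anderson e y')) <=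
    kth_eigenvalue k (linfun (anderson e x')) + (b - a) * C * e ^+ d.
  move=> xab yab xy.
  have := le1 x y xab yab xy.
  have := le1 y x yab xab (fun i ii0 => esym (xy i ii0)).
  move: (kth_eigenvalue _ _) (kth_eigenvalue _ _) => u v.
  by rewrite ler_norml; lra.
move=> xab yab xy; apply: eigenvalue_perturbation => // s f us sl fE.
rewrite (bigD1 i0)//= big1 ?addr0 => [|i ii0]; last by rewrite xy// subrr mul0r.
have sK : {in s, forall r, r <= K}.
  move=> r /sl rl; apply: le_trans rl _; apply: lamK => z.
  by have /andP[] := xab z.
have fi0 := sup _ _ _ i0 xab us sK fE.
have /andP[ax xb] := xab i0; have /andP[ay yb] := yab i0.
rewrite (_ : (b - a) * C * e ^+ d * dot f f = (b - a) * (C * e ^+ d * dot f f)).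
  apply: (@le_trans _ _ ((b - a) * f i0 ^+ 2)).
    by rewrite ler_wpM2r ?sqr_ge0// lerB.
  by rewrite ler_wpM2l// subr_ge0 (le_trans ax).
by rewrite !mulrA.
Qed.

Unset Implicit Arguments.

Theorem theorem1p3 (R : realType) (d : nat) (D : set 'rV[R]_d) (alpha : R)
    (a b : R) (U V : 'rV[R]_d -> R)
    (dO : R -> measure_display)
    (Omega : forall e : R, measurableType (dO e))
    (P : forall e : R, probability (Omega e) R)
    (xi : forall e : R, lattice_domain D e -> {RV (P e) >-> R}) :
  (0 < d)%N ->
  D !=set0 -> open D -> bounded_set D ->
  0 < alpha -> C1_holder_boundary alpha D ->
  a < b ->
  {within D, continuous U} -> (exists M : R, forall x, D x -> `|U x| <= M) ->
  {within D, continuous V} -> (exists M : R, forall x, D x -> `|V x| <= M) ->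
  (forall x, D x -> 0 < V x) ->
  (forall e : R, 0 < e ->
    [/\ mutually_independent (xi e),
        forall x : lattice_domain D e,
          {ae P e, forall w, a <= xi e x w <= b},
        forall x : lattice_domain D e,
          ('E_(P e)[xi e x] = (U (scaled e (val x)))%:E)%E
      & forall x : lattice_domain D e,
          ('V_(P e)[xi e x] = (V (scaled e (val x)))%:E)%E]) ->
  forall k : nat, (1 <= k)%N ->
  exists c : R, 0 < c /\
  forall t e : R, 0 < t -> 0 < e < 1 -> (k <= #|` lattice_domain D e|)%N ->
    let lambda (w : Omega e) : R :=
      kth_eigenvalue k (linfun (anderson e (fun x => xi e x w))) in
    (P e [set w | (t < `|lambda w - fine 'E_(P e)[lambda]%E|)%R]
       <= (4 * expR (- (c * t ^+ 2 * e ^- d)))%:E)%E.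

Proof.
move=> d0 D0 oD bD alpha0 _ ab _ _ _ _ _ Hxi k k1.
have [K HK] := eigenvalue_uniform_bound b d0 k1 D0 oD bD.
pose K' := Num.max a K.
have aK' : a <= K' by rewrite /K' le_max lexx.
have [C [C0 HC]] := delocalization d0 (ltW ab) aK'.
have [C' [C'0 HC']] := card_lattice_domain bD.
pose A := (b - a) * C; have A0 : 0 < A by rewrite mulr_gt0// subr_gt0.
have AC0 : 0 < 32 * (A ^+ 2 * C').
  by apply: mulr_gt0 => //; apply: mulr_gt0 => //; exact: exprn_gt0.
exists (32 * (A ^+ 2 * C'))^-1; split; first by rewrite invr_gt0.
move=> t e t0 e01 kS; cbv zeta; have /andP[e0 e1] := e01.
have [ind Xab _ _] := Hxi e e0.
have kS' : (0 < k <= #|{: lattice_domain D e}|)%N by rewrite k1 -cardfE.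
have ed0 : 0 < e ^+ d by rewrite exprn_gt0.
pose B := A ^+ 2 * C' * e ^+ d.
have B0 : 0 < B by apply: mulr_gt0 => //; apply: mulr_gt0 => //; exact: exprn_gt0.
have cB : (A * e ^+ d) ^+ 2 * #|{: lattice_domain D e}|%:R <= B.
  rewrite -cardfE exprMn -mulrA /B -mulrA ler_wpM2l ?sqr_ge0//.
  apply: (@le_trans _ _ ((e ^+ d) ^+ 2 * (C' * e ^- d))).
    by rewrite ler_wpM2l ?sqr_ge0// HC'.
  by rewrite mulrCA expr2 mulfK// gt_eqF.
have := @lipschitz_concentration _ _ R (P e) _ (xi e) a b
  (fun x => kth_eigenvalue k (linfun (anderson e x))) (A * e ^+ d) B t
  ab ind Xab _ _ cB B0 t0.
move=> /(_ _ _)/le_trans; apply.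
- by move=> x y eta; exact: eigenvalue_lipschitz.
- move=> x y i0 xab yab xy.
  apply: (@eigenvalue_bounded_difference R d _ e a b K' C k x y i0) => //.
  + exact: ltW.
  + by move=> x' s f z x'ab us sK fE; exact: (HC _ e x' s).
  + move=> x' x'b; rewrite /K' le_max; apply/orP; right; apply: HK => //.
    by rewrite -cardfE.
rewrite lee_fin ler_pM ?expR_ge0//; first by rewrite ler_nat.
rewrite ler_expR lerN2 le_eqVlt; apply/orP; left; apply/eqP.
rewrite /B; field; rewrite !gt_eqF//.
Qed.
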